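(* Let $U\subset\mathbb{R}^{n-1}$ be a domain, let $\mathbb{R}^n=\mathbb{R}^{n-1}\times\mathbb{R}$ carry a smooth density $e^{\psi}$ with $\psi=\psi(x_1,\dots,x_{n-1})$ independent of the last coordinate $x_n$, and let $S=\{(x_1,\dots,x_n): (x_1,\dots,x_{n-1})\in U,\ x_n=f(x_1,\dots,x_{n-1})\}$ be the graph of a smooth function $f:U\to\mathbb{R}$. If $S$ is weighted minimal, i.e. its weighted mean curvature $H_\psi$ vanishes identically, then $S$ is weighted area-minimizing in its homology class in $U\times\mathbb{R}$.
   Context: For a hypersurface in $\mathbb{R}^n$ with unit normal field $\mathbf{n}$ and density $e^\psi$, the weighted mean curvature is $H_\psi=H-\frac{1}{n-1}\frac{d\psi}{d\mathbf{n}}$, where $\frac{d\psi}{d\mathbf n}=\langle\nabla\psi,\mathbf n\rangle$ and $H$ is the classical mean curvature, with the sign convention that for a graph $S$ as in the claim, extending $\mathbf n$ to $U\times\mathbb{R}$ by translation along the $x_n$-axis, $(n-1)H=-\mathrm{div}(\mathbf n)$. The weighted area of a hypersurface $\Sigma$ is $\int_\Sigma e^\psi\,dA$ with $dA$ the Euclidean area element. $S$ is weighted area-minimizing in its homology class in $U\times\mathbb{R}$ if it has weighted area no larger than that of any hypersurface $\overline S$ in $U\times\mathbb{R}$ with $\partial S=\partial\overline S$ and $S-\overline S=\partial A$ for some (compactly supported) $n$-chain $A$ in $U\times\mathbb{R}$; if the weighted areas are infinite, they are compared inside a compact set outside of which $S$ and $\overline S$ coincide. *)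

(* Defs.v *)
From HB Require Import structures.
From mathcomp Require Import all_boot all_order all_algebra.
From mathcomp Require Import all_classical all_reals all_analysis.

Set Implicit Arguments.
Unset Strict Implicit.
Unset Printing Implicit Defensive.

Import Order.TTheory GRing.Theory Num.Theory.
Import numFieldNormedType.Exports.

Local Open Scope classical_set_scope.
Local Open Scope ring_scope.

(** * Euclidean space and calculus

    R^n is ['rV[R]_n].  Its library norm is the sup norm, which is used only
    through the topology; lengths are taken with [enorm]. *)

Section Calculus.
Context {R : realType}.

Definition dot {n : nat} (u v : 'rV[R]_n) : R := \sum_(i < n) u 0 i * v 0 i.

Definition enorm {n : nat} (u : 'rV[R]_n) : R := Num.sqrt (dot u u).

Definition partial {n : nat} (i : 'I_n) (f : 'rV[R]_n -> R) : 'rV[R]_n -> R :=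
  fun x => 'D_(delta_mx 0 i) f x.

Definition grad {n : nat} (f : 'rV[R]_n -> R) (x : 'rV[R]_n) : 'rV[R]_n :=
  \row_i partial i f x.

Definition div {n : nat} (X : 'rV[R]_n -> 'rV[R]_n) (x : 'rV[R]_n) : R :=
  \sum_(i < n) partial i (fun y => X y 0 i) x.

(* Meant for open [W] only: the partial derivatives are two-sided. *)
Fixpoint Ck {n : nat} (k : nat) (W : set 'rV[R]_n) (f : 'rV[R]_n -> R) : Prop :=
  (forall x, W x -> {for x, continuous f}) /\
  match k with
  | 0%N => True
  | k'.+1 => forall i : 'I_n,
      (forall x, W x -> derivable f x (delta_mx 0 i)) /\ Ck k' W (partial i f)
  end.

Definition smooth {n : nat} (W : set 'rV[R]_n) (f : 'rV[R]_n -> R) : Prop :=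
  forall k : nat, Ck k W f.

End Calculus.

(** * Lebesgue and Hausdorff measure on R^n

    Both are given as outer measures on all subsets.  They are only integrated
    against over the Borel sigma-algebra, on which they are measures. *)

Definition borelRn (R : realType) (n : nat) :=
  g_sigma_algebraType (@open 'rV[R]_n).

Section Measures.
Context {R : realType}.
Local Open Scope ereal_scope.

(* Infimum of the total volume of countable covers by closed boxes. *)
Definition lebesgue (n : nat) (A : set (borelRn R n)) : \bar R :=
  ereal_inf [set v | exists a b : nat -> 'rV[R]_n,
    [/\ forall j i, (a j 0 i <= b j 0 i)%R,
        A `<=` \bigcup_j [set x : 'rV[R]_n |
                           forall i, (a j 0 i <= x 0 i <= b j 0 i)%R]
      & v = \sum_(0 <= j <oo) (\prod_(i < n) (b j 0 i - a j 0 i))%R%:E]].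

(* omega_k, from omega_0 = 1, omega_1 = 2, omega_(k+2) = 2 pi omega_k / (k+2). *)
Fixpoint unit_ball_volume (k : nat) : R :=
  match k with
  | 0%N => 1%R
  | k1.+1 => match k1 with
             | 0%N => 2%R
             | k2.+1 => (2 * pi / k%:R * unit_ball_volume k2)%R
             end
  end.

Definition diam {n : nat} (A : set 'rV[R]_n) : \bar R :=
  ereal_sup [set (enorm (p.1 - p.2))%:E | p in A `*` A].

(* For k >= 1.  The normalization omega_k / 2^k makes the k-dimensional measure
   agree with Euclidean k-dimensional area.  Covering sets have diameter at most
   [d], so [fine] only sends the value [-oo] of [diam set0] to 0. *)
Definition hausdorff_pre (k n : nat) (d : R) (A : set 'rV[R]_n) : \bar R :=
  ereal_inf [set v | exists F : nat -> set 'rV[R]_n,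
    [/\ forall j, diam (F j) <= d%:E,
        A `<=` \bigcup_j F j
      & v = \sum_(0 <= j <oo)
              (unit_ball_volume k * (fine (diam (F j)) / 2) ^+ k)%R%:E]].

Definition hausdorff (k n : nat) (A : set (borelRn R n)) : \bar R :=
  ereal_sup [set hausdorff_pre k d A | d in [set d : R | (0 < d)%R]].

End Measures.

Arguments lebesgue {R} n A.
Arguments hausdorff {R} k n A.

(** * Oriented hypersurfaces and chains in R^(m+1)

    A hypersurface is a codimension-one rectifiable current: a rectifiable set
    with an orienting unit normal and a positive integer multiplicity.  A smooth
    embedded oriented hypersurface of locally finite area is the case of a smooth
    carrier with multiplicity 1.  The Euclidean area element is m-dimensional
    Hausdorff measure. *)

Record ohypersurface (R : realType) (m : nat) := OHypersurface {
  carrier : set 'rV[R]_(m + 1);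
  normal : 'rV[R]_(m + 1) -> 'rV[R]_(m + 1);
  mult : 'rV[R]_(m + 1) -> nat
}.

Section Hypersurfaces.
Context {R : realType} {m : nat}.
Local Notation E := 'rV[R]_(m + 1).
Local Notation B := (borelRn R (m + 1)).
Local Notation dA := (@hausdorff R m (m + 1)).
Local Notation vol := (@lebesgue R (m + 1)).
Implicit Types (S T : ohypersurface R m) (W K : set E) (psi : E -> R).

(* The piece { x in O | g x = 0 } of a C^1 hypersurface, with nu normal at x. *)
Definition C1_piece_at (O : set E) (g : E -> R) (x nu : E) : Prop :=
  [/\ O x, g x = 0 & exists c : R, nu = c *: grad g x].

Definition is_hypersurface W T : Prop :=
  [/\ carrier T `<=` W,
      [/\ measurable (carrier T : set B),
          forall i, measurable_fun (carrier T : set B)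
                      (fun x : B => normal T x 0 i : R)
        & measurable_fun (carrier T : set B) (mult T : B -> nat)],
      forall x, carrier T x -> enorm (normal T x) = 1 /\ (0 < mult T x)%N,
      forall K, compact K -> K `<=` W ->
        (\int[dA]_(x in (carrier T `&` K : set B)) ((mult T x)%:R)%:E < +oo)%E
    & exists (O : nat -> set E) (g : nat -> E -> R) (N : set E),
        [/\ forall j, [/\ open (O j), Ck 1 (O j) (g j)
                        & forall x, O j x -> grad (g j) x != 0],
            dA N = 0%E
          & forall x, carrier T x -> ~ N x ->
              exists j, C1_piece_at (O j) (g j) x (normal T x)]].

Definition weighted_area psi T K : \bar R :=
  \int[dA]_(x in (carrier T `&` K : set B)) ((mult T x)%:R * expR (psi x))%:E.

(* Differential forms of degree m on R^(m+1) are identified with vector fields,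
   X standing for the contraction of the volume form by X; the exterior
   derivative is then [div X] times the volume form, and integrating the form
   over a hypersurface with unit normal nu gives the flux of X along nu. *)
Definition flux T (X : E -> E) : R :=
  fine (\int[dA]_(x in (carrier T : set B))
          ((mult T x)%:R * dot (X x) (normal T x))%:E)%E.

Definition test_field W (X : E -> E) : Prop :=
  (forall i, smooth setT (fun x => X x 0 i)) /\
  exists K, [/\ compact K, K `<=` W & forall x, ~ K x -> X x = 0].

(* Forms of degree m - 1 are skew-symmetric matrix fields [a], with exterior
   derivative the vector field [skew_div a]. *)
Definition skew_div (a : E -> 'M[R]_(m + 1)) (x : E) : E :=
  \row_i \sum_(j < m + 1) partial j (fun y => a y i j) x.

Definition test_skew_field W (a : E -> 'M[R]_(m + 1)) : Prop :=
  [/\ forall x, (a x)^T = - a x,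
      forall i j, smooth setT (fun x => a x i j)
    & exists K, [/\ compact K, K `<=` W & forall x, ~ K x -> a x = 0]].

(* The boundaries of S and T are equal in W, where the boundary of S takes a
   form a to the integral of da over S. *)
Definition same_boundary W S T : Prop :=
  forall a, test_skew_field W a -> flux S (skew_div a) = flux T (skew_div a).

(* A chain of top dimension is an integer-valued density: at x, the number of
   times, counted with sign, that the chain covers x. *)
Definition is_chain W (A : E -> int) : Prop :=
  [/\ measurable_fun [set: B] (fun x : B => (A x)%:~R : R),
      (\int[vol]_(x in [set: B]) (`|(A x)%:~R : R|)%:E < +oo)%E
    & exists K, [/\ compact K, K `<=` W & forall x, ~ K x -> A x = 0]].

(* S - T is the boundary of A: Stokes' formula holds for all test forms. *)
Definition differ_by_boundary W S T (A : E -> int) : Prop :=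
  forall X, test_field W X ->
    flux S X - flux T X =
    fine (\int[vol]_(x in [set: B]) ((A x)%:~R * div X x)%:E)%E.

Definition homologous W S T : Prop :=
  same_boundary W S T /\
  exists A, is_chain W A /\ differ_by_boundary W S T A.

(* Equality off K up to sets of zero area. *)
Definition coincide_outside K S T : Prop :=
  exists2 N : set E, dA N = 0%E &
    forall x, ~ K x -> ~ N x ->
      (carrier S x <-> carrier T x) /\
      (carrier S x -> normal S x = normal T x /\ mult S x = mult T x).

Definition weighted_area_minimizing W psi S : Prop :=
  forall T, is_hypersurface W T -> homologous W S T ->
    (weighted_area psi S setT <= weighted_area psi T setT)%E /\
    (forall K, compact K -> K `<=` W -> coincide_outside K S T ->
       (weighted_area psi S K <= weighted_area psi T K)%E).

End Hypersurfaces.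

(** * Graphs over domains of R^m in R^(m+1) = R^m x R *)

Section Graphs.
Context {R : realType} {m : nat}.
Implicit Types (U : set 'rV[R]_m) (f : 'rV[R]_m -> R).
Local Notation E := 'rV[R]_(m + 1).

Definition cylinder U : set E := [set p | U (lsubmx p)].

Definition graph U f : set E :=
  [set p | U (lsubmx p) /\ rsubmx p 0 0 = f (lsubmx p)].

(* The upward unit normal, extended to [cylinder U] by vertical translation. *)
Definition graph_normal f (p : E) : E :=
  let g := grad f (lsubmx p) in
  (Num.sqrt (1 + dot g g))^-1 *: row_mx (- g) (const_mx 1).

Definition graph_hypersurface U f : ohypersurface R m :=
  OHypersurface (graph U f) (graph_normal f) (fun=> 1%N).

Definition mean_curvature f (p : E) : R := - div (graph_normal f) p / m%:R.

Definition weighted_mean_curvature (psi : E -> R) f (p : E) : R :=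
  mean_curvature f p - m%:R^-1 * dot (grad psi p) (graph_normal f p).

Definition weighted_minimal U (psi : E -> R) f : Prop :=
  forall p, graph U f p -> weighted_mean_curvature psi f p = 0.

End Graphs.

(* Main.v *)
Require Import Defs.
From HB Require Import structures.
From mathcomp Require Import all_boot all_order all_algebra.
From mathcomp Require Import all_classical all_reals all_analysis.
From mathcomp Require Import measurable_realfun ring lra.
Import Order.TTheory GRing.Theory Num.Theory.
Import numFieldNormedType.Exports.
Local Open Scope classical_set_scope.
Local Open Scope ring_scope.

Set Implicit Arguments.
Unset Strict Implicit.
Unset Printing Implicit Defensive.

(** The graph is calibrated.  Let n be its upward unit normal, extended to the
    cylinder over U by vertical translation, and let X = e^psi n
    ([weighted_normal]).  Since psi and n do not depend on the last coordinate,
    the equation div n + <grad psi, n> = 0, which says that the weighted mean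
    curvature vanishes on the graph, holds on the whole cylinder; it means that
    div X = 0 ([div_weighted_normal]).  If S - T is the boundary of A, then
    Stokes' formula says that X has the same flux through S as through T.  The
    former is the weighted area of S.  The latter is at most the weighted area
    of T, because |X| = e^psi.

    Stokes' formula is only available for smooth fields of compact support, so X
    is multiplied by a cutoff function chi that equals 1 near the support of A;
    on that support chi X is still divergence free.  This gives
    the integral of chi e^psi over S at most that over T
    ([calibration_inequality]).  Exhausting the cylinder by compact sets then
    compares the total areas ([total_area_le]).  If S and T coincide off K, then
    chi is taken to be 1 on K too, and the common part off K, whose integral is
    finite, is subtracted ([local_area_le]).

    Three facts support the argument.  Cutoff functions exist
    ([cutoff_exists]); they are built from exp(-1/t), and all fields in question
    are smooth by the calculus of [Ck].  Hausdorff measure is countably additive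
    on Borel sets, by Caratheodory's criterion ([open_caratheodory]), so the
    usual theorems on integrals apply to it.  Finally the graph has finite
    area in compact subsets of the cylinder, being locally a Lipschitz image of a
    cube ([graph_locally_finite]); without this a flux could be the default
    value that [fine] gives to an infinite integral. *)

(** * Functions of class C^k *)

Section SmoothFunctions.
Context {R : realType} {n : nat}.
Local Notation V := 'rV[R]_n.
Implicit Types (k : nat) (W : set V) (f g : V -> R) (x v : V).

(** Chain rule along a line: a directional derivative is the derivative at 0 of
    the restriction of [f] to the line through [x] along [v]. *)
Lemma is_derive_comp1 f (phi : R -> R) x v df dphi :
  is_derive x v f df -> is_derive (f x) 1 phi dphi ->
  is_derive x v (phi \o f) (dphi * df).
Proof.
move=> [fx <-] hphi.
pose F (h : R) := f (h *: v + x).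
have F0 : F 0 = f x by rewrite /F scale0r add0r.
have E (g : V -> R) : 'D_v g x = 'D_1 (fun h : R => g (h *: v + x)) 0.
  rewrite /derive; set g1 := fun h => h^-1 *: _; set g2 := fun h => h^-1 *: _.
  suff -> : g1 = g2 by [].
  by apply/funext => h; rewrite /g1 /g2 /= addr0 scale0r add0r [_%:A]mulr1.
have Fd : is_derive (0 : R) 1 F ('D_v f x).
  by rewrite E; apply: DeriveDef => //; exact: (iffLR (derivable1P f x v) fx).
have H : is_derive (0 : R) 1 (phi \o F) (dphi * 'D_v f x).
  rewrite -F0 in hphi.
  exact: (is_derive1_comp hphi Fd).
by apply: DeriveDef; [exact: (iffRL (derivable1P _ _ _) H.(ex_derive))|rewrite E; exact: H.(derive_val)].
Qed.

Lemma is_derive_mul f g x v df dg :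
  is_derive x v f df -> is_derive x v g dg ->
  is_derive x v (fun y => f y * g y) (f x * dg + g x * df).
Proof. by move=> hf hg; exact: (is_deriveM hf hg). Qed.

Lemma is_derive_mul1 (f g : R -> R) (t df dg : R) :
  is_derive t 1 f df -> is_derive t 1 g dg ->
  is_derive t 1 (fun y => f y * g y) (f t * dg + g t * df).
Proof. by move=> hf hg; exact: (is_deriveM hf hg). Qed.

Lemma Ck_continuous k W f x : Ck k W f -> W x -> {for x, continuous f}.
Proof. by case: k => [|k] [h _]; exact: h. Qed.

Lemma Ck_is_derive k W f x i : Ck k.+1 W f -> W x ->
  is_derive x (delta_mx 0 i) f (partial i f x).
Proof. by move=> [_ /(_ i)[h _]] Wx; apply: derivableP; exact: h. Qed.

Lemma Ck_pred k W f : Ck k.+1 W f -> Ck k W f.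
Proof.
elim: k f => [|k IH] f [hc hd]; first by split.
by split=> // i; have [dp dC] := hd i; split=> //; apply: IH.
Qed.

Lemma Ck_subset k W W' f : W' `<=` W -> Ck k W f -> Ck k W' f.
Proof.
move=> sW; elim: k f => [|k IH] f [hc hd]; split.
- by move=> x /sW; exact: hc.
- by [].
- by move=> x /sW; exact: hc.
- by move=> i; have [dp dC] := hd i; split; [move=> x /sW; exact: dp|exact: IH].
Qed.

Lemma open_near_eq W f g x : open W -> (forall y, W y -> f y = g y) -> W x ->
  \near x, f x = g x.
Proof. by move=> oW fg Wx; near=> y; apply: fg; near: y; exact: open_nbhs_nbhs.
Unshelve. all: by end_near. Qed.

Lemma near_eq_continuous f g x : (\near x, f x = g x) ->
  {for x, continuous f} -> {for x, continuous g}.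
Proof.
move=> fg; rewrite /prop_for /continuous_at -(nbhs_singleton fg) => h.
exact: cvg_trans (near_eq_cvg fg) h.
Qed.

Lemma Ck_eq k W f g : open W -> (forall x, W x -> f x = g x) ->
  Ck k W f -> Ck k W g.
Proof.
move=> oW; elim: k f g => [|k IH] f g fg [hc hd]; split => //.
- by move=> x Wx; exact: (near_eq_continuous (open_near_eq oW fg Wx) (hc x Wx)).
- by move=> x Wx; exact: (near_eq_continuous (open_near_eq oW fg Wx) (hc x Wx)).
- move=> i; have [dp dC] := hd i; split.
    move=> x Wx; exact: (near_eq_derivable (open_near_eq oW fg Wx) (dp x Wx)).
  apply: IH dC => x Wx; exact: (near_eq_derive _ (open_near_eq oW fg Wx)).
Qed.

(** Off W, [partial i f] is unrelated to the formula [df i] that one has for it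
    on W; as W is open, only the values on W matter for being C^k there. *)
Lemma CkS k W f (df : 'I_n -> V -> R) : open W ->
  (forall x, W x -> {for x, continuous f}) ->
  (forall i x, W x -> is_derive x (delta_mx 0 i) f (df i x)) ->
  (forall i, Ck k W (df i)) -> Ck k.+1 W f.
Proof.
move=> oW hc hd hk; split=> // i; split=> [x Wx|]; first exact: (hd i x Wx).(ex_derive).
apply: Ck_eq (hk i) => // x Wx; exact/esym/((hd i x Wx).(derive_val)).
Qed.

Lemma Ck_cst k W (c : R) : open W -> Ck k W (cst c).
Proof.
move=> oW; elim: k c => [|k IH] c; first by split=> // x _; exact: cst_continuous.
apply: (@CkS _ _ _ (fun=> cst 0)) => //.
by move=> x _; exact: cst_continuous.
Qed.

Lemma CkD k W f g : open W -> Ck k W f -> Ck k W g -> Ck k W (fun x => f x + g x).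
Proof.
move=> oW; elim: k f g => [|k IH] f g hf hg.
  split=> // x Wx; exact: (cvgD (Ck_continuous hf Wx) (Ck_continuous hg Wx)).
apply: (@CkS _ _ _ (fun i x => partial i f x + partial i g x)) => //.
- move=> x Wx; exact: (cvgD (Ck_continuous hf Wx) (Ck_continuous hg Wx)).
- move=> i x Wx; exact: (is_deriveD (Ck_is_derive i hf Wx) (Ck_is_derive i hg Wx)).
- by move=> i; apply: IH; [apply: (hf.2 i).2|apply: (hg.2 i).2].
Qed.

Lemma CkM k W f g : open W -> Ck k W f -> Ck k W g -> Ck k W (fun x => f x * g x).
Proof.
move=> oW; elim: k f g => [|k IH] f g hf hg.
  split=> // x Wx; exact: (cvgM (Ck_continuous hf Wx) (Ck_continuous hg Wx)).
apply: (@CkS _ _ _ (fun i x => f x * partial i g x + g x * partial i f x)) => //.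
- move=> x Wx; exact: (cvgM (Ck_continuous hf Wx) (Ck_continuous hg Wx)).
- move=> i x Wx; exact: (is_derive_mul (Ck_is_derive i hf Wx) (Ck_is_derive i hg Wx)).
- move=> i; apply: CkD => //; apply: IH; try exact: Ck_pred.
    by apply: (hg.2 i).2.
  by apply: (hf.2 i).2.
Qed.

Lemma CkN k W f : open W -> Ck k W f -> Ck k W (fun x => - f x).
Proof.
move=> oW hf; apply: (@Ck_eq _ _ (fun x => -1 * f x)) => //.
  by move=> x _; rewrite mulN1r.
by apply: CkM => //; exact: Ck_cst.
Qed.

Lemma Ck_sum k W (m : nat) (F : 'I_m -> V -> R) : open W ->
  (forall i, Ck k W (F i)) -> Ck k W (fun x => \sum_(i < m) F i x).
Proof.
move=> oW; elim: m F => [|m IH] F hF.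
  by apply: (@Ck_eq _ _ (cst 0)) => [//|x _|]; [rewrite big_ord0|exact: Ck_cst].
apply: (@Ck_eq _ _ (fun x => \sum_(i < m) F (widen_ord (leqnSn m) i) x + F ord_max x)) => //.
  by move=> x _; rewrite big_ord_recr.
by apply: CkD => //; apply: IH => i; exact: hF.
Qed.

Lemma is_derive_coord x v i : is_derive x v (fun y : V => y 0 i) (v 0 i).
Proof.
have did : derivable (id : V -> V) x v by exact: derivable_id.
apply: DeriveDef; first by move/derivable_mxP : (did) => /(_ 0 i).
have := derive_mx did; rewrite derive_id => /matrixP /(_ 0 i).
by rewrite mxE.
Qed.

Lemma Ck_coord k W i : open W -> Ck k W (fun x => x 0 i).
Proof.
move=> oW; case: k => [|k]; first by split=> // x _; exact: coord_continuous.
apply: (@CkS _ _ _ (fun j => cst ((delta_mx 0 j : V) 0 i))) => //.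
- by move=> x _; exact: coord_continuous.
- by move=> j x _; exact: is_derive_coord.
- by move=> j; exact: Ck_cst.
Qed.

(** The induction on k replaces the outer function by its derivative, hence needs
    a family [Phi] of functions of one variable that is closed under
    differentiation on I. *)
Lemma Ck_comp k W (Phi : set (R -> R)) (I : set R) g (phi : R -> R) : open W ->
  (forall psi, Phi psi -> exists2 dpsi, Phi dpsi &
     forall t, I t -> is_derive t 1 psi (dpsi t)) ->
  Phi phi -> (forall x, W x -> I (g x)) -> Ck k W g -> Ck k W (phi \o g).
Proof.
move=> oW hPhi Hphi gI; have cont psi x : Phi psi -> W x -> {for x, continuous g} ->
    {for x, continuous (psi \o g)}.
  move=> /hPhi[dpsi _ hd] Wx cg; apply: (continuous_comp cg).
  apply/differentiable_continuous/derivable1_diffP.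
  exact: (hd _ (gI x Wx)).(ex_derive).
elim: k phi Hphi => [|k IH] phi Hphi hg.
  by split=> // x Wx; apply: cont => //; exact: (Ck_continuous hg).
have [dphi Hdphi hd] := hPhi _ Hphi.
apply: (@CkS _ _ _ (fun i x => dphi (g x) * partial i g x)) => //.
- by move=> x Wx; apply: cont => //; exact: (Ck_continuous hg).
- move=> i x Wx; exact: (is_derive_comp1 (Ck_is_derive i hg Wx) (hd _ (gI x Wx))).
- move=> i; apply: CkM => //; first by apply: IH => //; exact: Ck_pred.
  by apply: (hg.2 i).2.
Qed.

Lemma Ck_expR k W g : open W -> Ck k W g -> Ck k W (fun x => expR (g x)).
Proof.
move=> oW; apply: (@Ck_comp _ _ [set expR] setT) => // _ ->.
by exists expR => // t _; exact: is_derive_expR.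
Qed.

Lemma is_derive_inv (t : R) : t != 0 -> is_derive t 1 (fun s : R => s^-1) (- t ^- 2).
Proof.
move=> t0; have := @is_deriveV R id t 1 1 t0 (is_derive_id _ _).
by rewrite /GRing.scale /= mulr1.
Qed.

Lemma is_derive_powV (t : R) (j : nat) : 0 < t ->
  is_derive t 1 (fun s => (s^-1) ^+ j) (- j%:R * (t^-1) ^+ j.+1).
Proof.
move=> t0; have tn0 : t != 0 by rewrite gt_eqF.
have h1 := is_derive_inv tn0.
elim: j => [|j IH]; first by rewrite oppr0 mul0r; exact: is_derive_cst.
have -> : (fun s : R => s^-1 ^+ j.+1) = (fun s => s^-1 * s^-1 ^+ j).
  by apply/funext => s; rewrite exprS.
apply: (is_derive_eq (is_derive_mul1 h1 IH)).
by rewrite -exprVn !exprS -natr1; ring.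
Qed.

Lemma Ck_inv k W g : open W -> (forall x, W x -> 0 < g x) ->
  Ck k W g -> Ck k W (fun x => (g x)^-1).
Proof.
move=> oW g0.
apply: (@Ck_comp _ _ [set (fun t => p.1 * t^-1 ^+ p.2) | p in setT]
   [set t | 0 < t] g (fun t => t^-1)) => //; last first.
  by exists (1, 1%N) => //; apply/funext => t; rewrite mul1r expr1.
move=> _ [[c j] _ <-] /=; exists (fun t => (- j%:R * c) * t^-1 ^+ j.+1).
  by exists (- j%:R * c, j.+1).
move=> t t0; apply: (is_derive_eq (is_derive_mul1 (is_derive_cst c t 1) (is_derive_powV j t0))).
by rewrite mulr0 addr0 mulrA [c * _]mulrC.
Qed.

Lemma Ck_sqrt k W g : open W -> (forall x, W x -> 0 < g x) ->
  Ck k W g -> Ck k W (fun x => Num.sqrt (g x)).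
Proof.
move=> oW g0.
apply: (@Ck_comp _ _
   [set (fun t => p.1 * t^-1 ^+ p.2 * Num.sqrt t) | p in setT]
   [set t | 0 < t] g Num.sqrt) => //; last first.
  by exists (1, 0%N) => //; apply/funext => t; rewrite !mul1r.
move=> _ [[c j] _ <-] /=.
exists (fun t => (c * (2^-1 - j%:R)) * t^-1 ^+ j.+1 * Num.sqrt t).
  by exists (c * (2^-1 - j%:R), j.+1).
move=> t t0; have h := is_derive_mul1 (is_derive_cst c t 1) (is_derive_powV j t0).
apply: (is_derive_eq (is_derive_mul1 h (is_derive1_sqrt t0))).
have s0 : Num.sqrt t != 0 by rewrite gt_eqF // sqrtr_gt0.
have -> : (2 * Num.sqrt t)^-1 = 2^-1 * t^-1 * Num.sqrt t.
  rewrite -[in t^-1](sqr_sqrtr (ltW t0)) expr2; field.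
  by rewrite s0.
by rewrite /= mulr0 addr0 !exprS; move: (t^-1) (2^-1 : R) => u w; ring.
Qed.

End SmoothFunctions.

(** * The flat function exp(-1/t) *)

Section FlatFunction.
Context {R : realType}.
Implicit Types (p q : {poly R}) (t s h C : R).

Lemma pow_expR_bounded (j : nat) s : 0 <= s -> s ^+ j * expR (- s) <= j`!%:R.
Proof.
case: j => [|j] s0.
  by rewrite expr0 mul1r fact0 expR_le1 oppr_le0.
rewrite expRN ler_pdivrMr ?expR_gt0 // mulrC -ler_pdivrMr ?ltr0n ?fact_gt0 //.
by apply: le_trans (expR_ge1Dxn j s0); rewrite lerDr.
Qed.

Lemma poly_expR_bounded p : exists C,
  forall s, 0 <= s -> `|p.[s]| * expR (- s) <= C.
Proof.
exists (\sum_(i < size p) `|p`_i| * i`!%:R) => s s0.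
rewrite horner_coef -[expR _]ger0_norm ?expR_ge0 // -normrM mulr_suml.
apply: le_trans (ler_norm_sum _ _ _) _; apply: ler_sum => i _.
rewrite -mulrA normrM ler_wpM2l // ger0_norm ?pow_expR_bounded //.
by rewrite mulr_ge0 ?exprn_ge0 ?expR_ge0.
Qed.

(** The functions p(1/t) exp(-1/t), extended by 0 to t <= 0, form a family closed
    under differentiation; p = 1 is the classical flat function. *)
Definition flat p t : R := if 0 < t then p.[t^-1] * expR (- t^-1) else 0.

Lemma is_derive_quadratic0 (F : R -> R) C : F 0 = 0 ->
  (forall h, `|F h| <= C * h ^+ 2) -> is_derive (0 : R) 1 F 0.
Proof.
move=> F0 FC.
have H : h^-1 *: ((F \o shift 0) (h *: 1) - F 0) @[h --> 0^'] --> (0 : R).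
  apply/cvgr0Pnorm_le => e e0; near=> h => /=.
  have hn0 : h != 0 by near: h; exact: nbhs_dnbhs_neq.
  rewrite F0 subr0 addr0 [h *: 1]mulr1 [_ *: _]/(_ * _) normrM normfV.
  rewrite ler_pdivrMl ?normr_gt0 //.
  apply: le_trans (FC h) _; rewrite -real_normK ?num_real // expr2 mulrA mulrC.
  rewrite ler_wpM2l //.
  have C1 : 0 < `|C| + 1 by rewrite ltr_pwDr.
  have : `|h| <= e / (`|C| + 1).
    by near: h; apply: dnbhs0_le; rewrite divr_gt0.
  rewrite ler_pdivlMr // => h2; apply: le_trans h2; rewrite mulrC ler_wpM2l //.
  by rewrite (le_trans (ler_norm C)) // lerDl.
by apply: DeriveDef; [apply/cvg_ex; exists 0|exact/cvg_lim].
Unshelve. all: by end_near. Qed.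

(** For t > 0 this is the product rule, with s = 1/t and ds/dt = - s^2.  At 0 it
    holds because p(s) s^2 exp(-s) is bounded, which makes [flat p] O(t^2). *)
Lemma is_derive_flat p t : is_derive t 1 (flat p) (flat ('X^2 * (p - p^`())) t).
Proof.
rewrite {2}/flat; have [t0|] := ltP 0 t; last rewrite le_eqVlt => /predU1P[->|t0].
- have tn0 : t != 0 by rewrite gt_eqF.
  have h1 := is_derive_inv tn0.
  have h2 := is_derive1_comp (is_derive_poly p t^-1) h1.
  have h1N : is_derive t 1 (fun s : R => - s^-1) (- - t ^- 2) := is_deriveN h1.
  have h3 := @is_derive1_comp R expR (fun s => - s^-1) t _ _ (is_derive_expR (- t^-1)) h1N.
  have h4 := is_derive_mul1 h2 h3.
  apply: (near_eq_is_derive _ (is_derive_eq h4 _)).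
    near=> s; rewrite /flat ifT //=; near: s; exact: lt_nbhsr.
  rewrite /= hornerM hornerXn hornerD hornerN -exprVn opprK.
  by move: (t^-1) (expR _) => u w; ring.
- have [C hC] := poly_expR_bounded ('X^2 * p).
  have C0 : 0 <= C by apply: le_trans (hC 0 (lexx _)); rewrite mulr_ge0 ?expR_ge0.
  apply: (@is_derive_quadratic0 _ C); first by rewrite /flat ltxx.
  move=> h; rewrite /flat; case: ltP => [h0|_]; last by rewrite normr0 mulr_ge0 ?sqr_ge0.
  have := hC h^-1; rewrite invr_ge0 => /(_ (ltW h0)).
  rewrite hornerM hornerXn normrM [`|_ ^+ 2|]ger0_norm ?exprn_ge0 ?invr_ge0 ?(ltW h0) //.
  rewrite normrM [`|expR _|]ger0_norm ?expR_ge0 // exprVn -mulrA ler_pdivrMl ?exprn_gt0 //.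
  by rewrite mulrC [_ * C]mulrC.
- apply: (near_eq_is_derive _ (is_derive_cst 0 t 1)).
  near=> s; rewrite /flat ifF //; apply/negbTE; rewrite -leNgt ltW //.
  near: s; exact: lt_nbhsl.
Unshelve. all: by end_near. Qed.

Lemma Ck_flat {n : nat} k (W : set 'rV[R]_n) g : open W -> Ck k W g ->
  Ck k W (fun x => flat 1 (g x)).
Proof.
move=> oW; apply: (@Ck_comp R n k W [set flat p | p in setT] setT g) => //.
  move=> _ [p _ <-]; exists (flat ('X^2 * (p - p^`()))) => [|t _]; first by eexists.
  exact: is_derive_flat.
Qed.

Lemma flat_ge0 t : 0 <= flat 1 t.
Proof. by rewrite /flat; case: ifP => // _; rewrite hornerC mul1r expR_ge0. Qed.

Lemma flat_gt0 t : 0 < t -> 0 < flat 1 t.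
Proof. by rewrite /flat => ->; rewrite hornerC mul1r expR_gt0. Qed.

Lemma flat_le0 t : t <= 0 -> flat 1 t = 0.
Proof. by rewrite /flat leNgt => /negbTE ->. Qed.

End FlatFunction.

(** * Euclidean length and the sup norm *)

Section EuclideanNorm.
Context {R : realType} {n : nat}.
Implicit Types u v : 'rV[R]_n.

Lemma dot_ge0 u : 0 <= dot u u.
Proof. by apply: sumr_ge0 => i _; rewrite -expr2 sqr_ge0. Qed.

Lemma sqr_coord_le_dot u i : u 0 i ^+ 2 <= dot u u.
Proof.
rewrite /dot (bigD1 i) //= -expr2 lerDl sumr_ge0 // => j _.
by rewrite -expr2 sqr_ge0.
Qed.

Lemma rV_norm_leP u r : 0 <= r -> reflect (forall i, `|u 0 i| <= r) (`|u| <= r).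
Proof.
move=> r0; rewrite [`|u|]mx_normrE; apply: (iffP idP).
  by move=> /bigmax_leP[_ h] i; exact: (h (0, i)).
by move=> h; apply: bigmax_le => // -[i j] _ /=; rewrite (ord1 i).
Qed.

Lemma norm_le_enorm u : `|u| <= enorm u.
Proof.
apply/rV_norm_leP => [|i]; first exact: sqrtr_ge0.
by rewrite -sqrtr_sqr ler_wsqrtr // sqr_coord_le_dot.
Qed.

Lemma enorm_le_norm u : enorm u <= Num.sqrt n%:R * `|u|.
Proof.
rewrite -[X in _ * X]ger0_norm // -sqrtr_sqr -sqrtrM // ler_wsqrtr //.
rewrite /dot mulrC mulr_natr -[X in _ *+ X](card_ord n) -sumr_const.
apply: ler_sum => i _; rewrite -expr2 -real_normK ?num_real // ler_sqr ?nnegrE //.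
by have /rV_norm_leP := lexx `|u|; apply.
Qed.

Lemma dot_unit_le1 u v : dot u u = 1 -> dot v v = 1 -> dot u v <= 1.
Proof.
move=> u1 v1; have : 0 <= dot (u - v) (u - v) by exact: dot_ge0.
have -> : dot (u - v) (u - v) = dot u u + dot v v - 2 * dot u v.
  rewrite /dot mulr_sumr -big_split /= -sumrB; apply: eq_bigr => i _.
  by rewrite !mxE; ring.
rewrite u1 v1; lra.
Qed.

End EuclideanNorm.

(** * Compact sets *)

Section Compactness.

(** Heine-Borel as an induction principle: a property of sets that passes to
    subsets and finite unions, and holds locally, holds on compact sets. *)
Lemma compact_ind (T : ptopologicalType) (P : set T -> Prop) (K : set T) :
  P set0 -> (forall A B, P A -> P B -> P (A `|` B)) ->
  (forall A B, A `<=` B -> P B -> P A) ->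
  (forall x, K x -> exists2 V, nbhs x V & P V) -> compact K -> P K.
Proof.
move=> P0 PU PS PK; rewrite compact_cover => Kc.
have /choice[V hV] : forall x : T, exists V, K x -> nbhs x V /\ P V.
  move=> x; have [Kx|nKx] := pselect (K x); last by exists setT.
  by have [V xV PV] := PK x Kx; exists V.
have [D sD KD] : finite_subset_cover K (fun x => (V x)^°) K.
  apply: Kc => [x _|x Kx]; first exact: open_interior.
  by exists x => //; exact: (hV x Kx).1.
apply: (PS _ _ KD); rewrite /cover.
have sD' x : x \in finmap.enum_fset D -> K x by move=> /sD; rewrite inE.
rewrite bigcup_fset; move: (finmap.enum_fset D) sD' => s.
elim: s => [|x s IH] sK; first by rewrite big_nil.
rewrite big_cons; apply: PU; last by apply: IH => y ys; apply: sK; rewrite inE ys orbT.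
apply: (PS _ (V x)); first exact: interior_subset.
by apply: (hV x _).2; apply: sK; rewrite inE eqxx.
Qed.

Lemma closed_ball_rV_compact (R : realType) n (x : 'rV[R]_n) (r : R) :
  compact [set y : 'rV[R]_n | `|y - x| <= r].
Proof.
apply: bounded_closed_compact.
  exists (r + `|x|); split; first exact: num_real.
  move=> M rM y /= yx; rewrite (le_trans _ (ltW rM)) // -[y](subrK x).
  by rewrite (le_trans (ler_normD _ _)) // lerD2r.
rewrite (_ : mkset _ = closed_ball_ Num.norm x r); first exact: closed_closed_ball_.
by apply/funext => y; rewrite /closed_ball_ /mkset distrC.
Qed.

End Compactness.

Section InnerParts.
Context {R : realType} {n : nat}.
Local Notation V := 'rV[R]_n.
Implicit Types (O : set V).

Definition inner_part O (j : nat) : set V :=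
  [set x | forall y, ~ O y -> j.+1%:R^-1 <= `|x - y|].

Lemma le_inner_part O i j : (i <= j)%N -> inner_part O i `<=` inner_part O j.
Proof.
move=> ij x Ax y Oy; apply: le_trans (Ax y Oy).
by rewrite lef_pV2 ?posrE ?ltr0n // ler_nat ltnS.
Qed.

Lemma inner_part_subset O j : inner_part O j `<=` O.
Proof.
move=> x Ax; apply: contrapT => /Ax; rewrite subrr normr0 leNgt.
by rewrite invr_gt0 ltr0n.
Qed.

Lemma inner_part_exhausts O x : open O -> O x -> exists j, inner_part O j x.
Proof.
move=> oO Ox; have /nbhs_ballP[e /= e0 eO] := oO x Ox.
have je : (Num.truncn e^-1).+1%:R^-1 < e.
  by rewrite -[ltRHS]invrK ltf_pV2 ?posrE ?invr_gt0 ?ltr0n //; exact: Num.Theory.truncnS_gt.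
exists (Num.truncn e^-1) => y Oy; rewrite leNgt; apply/negP => xy; apply: Oy; apply: eO.
by rewrite -ball_normE /ball_ /= (lt_trans xy).
Qed.

Lemma closed_inner_part O j : closed (inner_part O j).
Proof.
rewrite (_ : inner_part O j = \bigcap_(y in ~` O) ~` ball y (j.+1%:R^-1)).
  apply: closed_bigI => y _; apply: open_closedC; exact: ball_open.
apply/seteqP; split=> x h y /h; rewrite -ball_normE /ball_ /= distrC.
  by rewrite leNgt => /negP.
by move=> /negP; rewrite -leNgt.
Qed.

Lemma compact_exhaustion O : open O -> exists K : nat -> set V,
  [/\ forall j, compact (K j) /\ K j `<=` O,
      {homo K : i j / (i <= j)%N >-> i `<=` j} & O `<=` \bigcup_j K j].
Proof.
move=> oO; exists (fun j => inner_part O j `&` [set x | `|x - 0| <= j%:R]); split.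
- move=> j; split; last by move=> x [/inner_part_subset].
  have cB := @closed_ball_rV_compact R n 0 j%:R.
  rewrite /=; refine (subclosed_compact _ cB (@subIsetr _ _ _)).
  apply: closedI; first exact: closed_inner_part.
  apply: compact_closed; first exact: norm_hausdorff.
  exact: closed_ball_rV_compact.
- move=> i j ij x [xi xr]; split; first exact: le_inner_part xi.
  by apply: le_trans xr _; rewrite ler_nat.
- move=> x Ox; have [i xi] := inner_part_exhausts oO Ox.
  exists (maxn i (Num.truncn `|x|).+1) => //; split.
    by apply: le_inner_part xi; exact: leq_maxl.
  rewrite /= subr0; apply: le_trans (ltW (Num.Theory.truncnS_gt _)) _.
  by rewrite ler_nat leq_maxr.
Qed.

End InnerParts.

(** * Smooth cutoff functions *)

Section Cutoff.
Context {R : realType} {n : nat}.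
Local Notation V := 'rV[R]_n.
Implicit Types (W A B : set V) (chi : V -> R).

(** The last clause asks for [chi] to be 1 near each point of A, so that its
    derivatives vanish there. *)
Definition cutoff W A chi : Prop :=
  [/\ smooth setT chi, forall x, 0 <= chi x <= 1,
      exists K, [/\ compact K, K `<=` W & forall x, ~ K x -> chi x = 0]
    & forall x, A x -> \near x, chi x = 1].

Lemma cutoff_set0 W : cutoff W set0 (cst 0).
Proof.
split=> //; first by move=> k; exact: Ck_cst openT.
- by move=> x; rewrite lexx ler01.
- by exists set0; split=> //; exact: compact0.
Qed.

(** The formula is 1 - (1 - chi1) (1 - chi2). *)
Lemma cutoffU W A B chi1 chi2 : cutoff W A chi1 -> cutoff W B chi2 ->
  cutoff W (A `|` B) (fun x => chi1 x + chi2 x - chi1 x * chi2 x).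
Proof.
move=> [s1 b1 [K1 [cK1 KW1 z1]] o1] [s2 b2 [K2 [cK2 KW2 z2]] o2]; split.
- move=> k; apply: CkD; first exact: openT.
    by apply: CkD; [exact: openT|exact: s1|exact: s2].
  by apply: CkN; [exact: openT|apply: CkM; [exact: openT|exact: s1|exact: s2]].
- by move=> x; have := b1 x; have := b2 x; move: (chi1 x) (chi2 x) => a b; nra.
- exists (K1 `|` K2); split; [exact: compactU|by move=> x [/KW1|/KW2]|].
  by move=> x /not_orP[/z1-> /z2->]; rewrite addr0 mulr0 subr0.
- move=> x [/o1 h|/o2 h]; near=> y.
    by have -> : chi1 y = 1 by [near: y]; rewrite mul1r addrK.
  by have -> : chi2 y = 1 by [near: y]; rewrite mulr1 addrAC subrr add0r.
Unshelve. all: by end_near. Qed.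

Lemma cutoff_subset W A B chi : A `<=` B -> cutoff W B chi -> cutoff W A chi.
Proof. by move=> AB [h1 h2 h3 h4]; split=> // x /AB; exact: h4. Qed.

(** With q the squared distance to x and e the flat function, take
    e(r^2 - q) / (e(r^2 - q) + e(q - r^2/4)): the numerator vanishes for q >= r^2,
    and the second term of the denominator for q <= r^2/4. *)
Lemma cutoff_near W x : open W -> W x ->
  exists2 A, nbhs x A & exists chi, cutoff W A chi.
Proof.
move=> oW Wx; have [r /= r0 rW] : exists2 r, 0 < r & forall y, `|y - x| <= r -> W y.
  have /nbhs_ballP[e /= e0 eW] := oW x Wx.
  exists (e / 2) => [|y yx]; first by rewrite divr_gt0.
  apply: eW; rewrite -ball_normE /ball_ /= distrC; apply: le_lt_trans yx _.
  by rewrite ltr_pdivrMr // ltr_pMr // ltr1n.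
pose q (y : V) := dot (y - x) (y - x).
have qC k : Ck k setT q.
  have cC i : Ck k setT (fun y : V => (y - x) 0 i).
    apply: (@Ck_eq _ _ _ _ (fun y : V => y 0 i + cst (- x 0 i) y)); first exact: openT.
      by move=> y _; rewrite !mxE.
    by apply: CkD; [exact: openT|apply: Ck_coord; exact: openT|apply: Ck_cst; exact: openT].
  by apply: Ck_sum; [exact: openT|move=> i; apply: CkM; [exact: openT|exact: cC|exact: cC]].
have qc : continuous q by move=> y; exact: (Ck_continuous (qC 0%N) I).
pose A : set V := [set y | q y < r ^+ 2 / 4].
have oA : open A by apply: (@open_comp _ _ q [set t | t < r ^+ 2 / 4]) => [y _|]; [exact: qc|exact: open_lt].
have Ax : A x.
  rewrite /A /= /q subrr /dot big1 ?divr_gt0 ?exprn_gt0 // => i _.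
  by rewrite mxE mul0r.
exists A; first exact: open_nbhs_nbhs.
pose a y := flat 1 (r ^+ 2 - q y); pose b y := flat 1 (q y - r ^+ 2 / 4).
have r2 : 0 < r ^+ 2 by rewrite exprn_gt0.
have ab y : 0 < a y + b y.
  have [h|h] := ltP (q y) (r ^+ 2).
    by rewrite ltr_pwDl ?flat_ge0 // flat_gt0 // subr_gt0.
  rewrite ltr_wpDl ?flat_ge0 // flat_gt0 // subr_gt0.
  by apply: lt_le_trans h; rewrite ltr_pdivrMr // ltr_pMr // ltr1n.
have aC k : Ck k setT a.
  apply: Ck_flat; first exact: openT.
  by apply: CkD; [exact: openT|apply: Ck_cst; exact: openT|apply: CkN => //; exact: openT].
have bC k : Ck k setT b.
  apply: Ck_flat; first exact: openT.
  by apply: CkD; [exact: openT|exact: qC|apply: Ck_cst; exact: openT].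
exists (fun y => a y * (a y + b y)^-1); split.
- move=> k; apply: CkM; [exact: openT|exact: aC|].
  apply: Ck_inv; [exact: openT|by move=> y _|].
  by apply: CkD; [exact: openT|exact: aC|exact: bC].
- move=> y; rewrite divr_ge0 ?flat_ge0 ?(ltW (ab y)) //= ler_pdivrMr ?ab //.
  by rewrite mul1r lerDl flat_ge0.
- exists [set y | `|y - x| <= r]; split; [exact: closed_ball_rV_compact|by move=> y /rW|].
  move=> y /= yr; rewrite /a flat_le0 ?mul0r // subr_le0 leNgt; apply/negP => h.
  apply: yr; apply: le_trans (norm_le_enorm _) _.
  by rewrite -[leRHS]ger0_norm ?(ltW r0) // -sqrtr_sqr ler_wsqrtr // ltW.
- move=> y Ay; have yA : nbhs y A by exact: open_nbhs_nbhs.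
  near=> z; rewrite /b flat_le0 ?addr0 ?divff // ?subr_le0.
    by have := ab z; rewrite /b flat_le0 ?addr0 => [/gt_eqF/negbT//|]; rewrite subr_le0 ltW //; near: z.
  by rewrite ltW //; near: z.
Unshelve. all: by end_near. Qed.

Lemma cutoff_exists W K : open W -> compact K -> K `<=` W -> exists chi, cutoff W K chi.
Proof.
move=> oW cK KW; move: cK; apply: (@compact_ind _ (fun A => exists chi, cutoff W A chi)).
- by exists (cst 0); exact: cutoff_set0.
- by move=> A B [c1 h1] [c2 h2]; eexists; exact: cutoffU h1 h2.
- by move=> A B AB [c h]; exists c; exact: cutoff_subset h.
- by move=> x /KW; exact: cutoff_near.
Qed.

End Cutoff.

(** * Hausdorff measure is a measure on Borel sets *)

Section HausdorffPremeasure.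
Context {R : realType} {k n : nat}.
Local Notation V := 'rV[R]_n.
Local Notation pre := (@hausdorff_pre R k.+1 n).
Local Notation mu := (@hausdorff R k.+1 n).
Local Open Scope ereal_scope.
Implicit Types (A B F : set V) (d e : R).

Lemma unit_ball_volume_ge0 j : (0 <= unit_ball_volume j :> R)%R.
Proof.
have [m] := ubnP j; elim: m j => // m IH [|[|j]] //= jm.
rewrite !mulr_ge0 ?pi_ge0 ?invr_ge0 // IH //.
by rewrite ltnS in jm; rewrite (leq_trans _ jm).
Qed.

Lemma diam_set0 : diam (set0 : set V) = -oo.
Proof. by rewrite /diam setX0 image_set0 ereal_sup0. Qed.

Lemma enorm_le_diam F x y : F x -> F y -> (enorm (x - y))%:E <= diam F.
Proof. by move=> Fx Fy; apply: ereal_sup_ubound; exists (x, y). Qed.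

Lemma fine_diam_ge0 F : (0 <= fine (diam F))%R.
Proof.
have [->|/set0P[x Fx]] := eqVneq F set0; first by rewrite diam_set0.
by apply: fine_ge0; apply: le_trans (enorm_le_diam Fx Fx); rewrite lee_fin sqrtr_ge0.
Qed.

(** The volume of a ball of dimension k + 1 with the diameter of F. *)
Definition ball_volume F : \bar R :=
  (unit_ball_volume k.+1 * (fine (diam F) / 2) ^+ k.+1)%R%:E.

Lemma ball_volume_ge0 F : 0 <= ball_volume F.
Proof.
rewrite lee_fin mulr_ge0 ?unit_ball_volume_ge0 // exprn_ge0 //.
by rewrite divr_ge0 ?fine_diam_ge0.
Qed.

Lemma ball_volume0 : ball_volume set0 = 0.
Proof. by rewrite /ball_volume diam_set0 /= mul0r expr0n mulr0. Qed.

Lemma hausdorff_pre_le d A (F : nat -> set V) : (forall j, diam (F j) <= d%:E) ->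
  A `<=` \bigcup_j F j -> pre d A <= \sum_(0 <= j <oo) ball_volume (F j).
Proof. by move=> dF AF; apply: ereal_inf_lbound; exists F. Qed.

Lemma hausdorff_pre_ge d A v : (forall F : nat -> set V,
   (forall j, diam (F j) <= d%:E) -> A `<=` \bigcup_j F j ->
   v <= \sum_(0 <= j <oo) ball_volume (F j)) -> v <= pre d A.
Proof. by move=> h; apply: le_ereal_inf_tmp => _ [F [dF AF ->]]; exact: h. Qed.

Lemma hausdorff_pre_anti d e A : (d <= e)%R -> pre e A <= pre d A.
Proof.
move=> de; apply: hausdorff_pre_ge => F dF; apply: hausdorff_pre_le => j.
by apply: le_trans (dF j) _; rewrite lee_fin.
Qed.

(** Penalizing sets of large diameter by an infinite cost identifies
    [hausdorff_pre] with [mu_ext] of a set function defined on all sets, that is,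
    on the sigma-algebra [D]; so it is countably subadditive. *)
Let cost d F : \bar R := if diam F <= d%:E then ball_volume F else +oo.

Let cost_ge0 d F : 0 <= cost d F.
Proof. by rewrite /cost; case: ifP => // _; exact: ball_volume_ge0. Qed.

Let cost0 d : cost d set0 = 0.
Proof. by rewrite /cost diam_set0 leNye ball_volume0. Qed.

Let D := g_sigma_algebraType [set: set V].

Let hausdorff_preE d A : pre d A = mu_ext (cost d : set D -> \bar R) A.
Proof.
apply/eqP; rewrite eq_le; apply/andP; split.
  apply: le_ereal_inf_tmp => _ [F [_ AF] <-].
  have [dF|] := pselect (forall j, diam (F j) <= d%:E).
    apply: le_trans (hausdorff_pre_le dF AF) _.
    by apply: lee_nneseries => [j _ _|j _]; [exact: ball_volume_ge0|rewrite /cost dF].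
  move=> /existsNP[j /negP dj]; rewrite (eseries_pinfty _ _ (k:=j)) ?leey //.
    by move=> i _; rewrite gt_eqF // (lt_le_trans _ (cost_ge0 d (F i))).
  by rewrite /cost (negbTE dj).
apply: hausdorff_pre_ge => F dF AF; apply: ereal_inf_lbound; exists F.
  by split=> // i; exact: sub_sigma_algebra.
by apply: eq_eseriesr => j _; rewrite /cost dF.
Qed.

Lemma hausdorff_pre_ge0 d A : 0 <= pre d A.
Proof. by rewrite hausdorff_preE; exact: (@mu_ext_ge0 _ D R (cost d) (@cost_ge0 d) A). Qed.

Lemma hausdorff_pre0 d : pre d set0 = 0.
Proof. by rewrite hausdorff_preE; exact: (@mu_ext0 _ D R (cost d) (cost0 d) (@cost_ge0 d)). Qed.

Lemma le_hausdorff_pre d A B : A `<=` B -> pre d A <= pre d B.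
Proof. by move=> AB; rewrite !hausdorff_preE; exact: (@le_mu_ext _ D R (cost d) A B AB). Qed.

Lemma hausdorff_pre_sigma_subadditive d (F : nat -> set V) :
  pre d (\bigcup_j F j) <= \sum_(0 <= j <oo) pre d (F j).
Proof.
rewrite hausdorff_preE; apply: le_trans.
  exact: (@mu_ext_sigma_subadditive _ D R (cost d) (@cost_ge0 d) F).
by apply: lee_nneseries => j _ *; rewrite -hausdorff_preE ?hausdorff_pre_ge0.
Qed.

(** A set of diameter less than e cannot meet both A and B, so a cover of the
    union splits into a cover of A and a cover of B. *)
Lemma hausdorff_pre_separated d e A B : (d < e)%R ->
  (forall a b, A a -> B b -> (e <= enorm (a - b))%R) ->
  pre d A + pre d B <= pre d (A `|` B).
Proof.
move=> de AB; apply: (@hausdorff_pre_ge d (A `|` B)) => F dF ABF.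
pose meeting C j := if `[< F j `&` C !=set0 >] then F j else set0.
have dm C j : diam (meeting C j) <= d%:E.
  by rewrite /meeting; case: asboolP => // _; rewrite diam_set0 leNye.
have cm C : C `<=` A `|` B -> C `<=` \bigcup_j meeting C j.
  move=> CAB x Cx; have [j _ Fjx] := ABF x (CAB x Cx); exists j => //.
  by rewrite /meeting; case: asboolP => // -[]; exists x.
have hA := hausdorff_pre_le (dm A) (cm A (@subsetUl _ A B)).
have hB := hausdorff_pre_le (dm B) (cm B (@subsetUr _ A B)).
apply: le_trans (leeD hA hB) _.
rewrite -nneseriesD; [|by move=> *; exact: ball_volume_ge0|by move=> *; exact: ball_volume_ge0].
apply: lee_nneseries => [j _ _|j _].
  by apply: adde_ge0; exact: ball_volume_ge0.
rewrite /meeting; case: asboolP => [[a [Fa Aa]]|_]; case: asboolP => [[b [Fb Bb]]|_].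
- have := le_trans (enorm_le_diam Fa Fb) (dF j).
  by rewrite lee_fin leNgt (lt_le_trans de) //; exact: AB.
- by rewrite ball_volume0 adde0.
- by rewrite ball_volume0 add0e.
- by rewrite ball_volume0 adde0 ball_volume_ge0.
Qed.

Lemma hausdorff_pre_le_hausdorff d A : (0 < d)%R -> pre d A <= mu A.
Proof. by move=> d0; apply: ereal_sup_ubound; exists d. Qed.

Lemma hausdorff_le A v : (forall d, (0 < d)%R -> pre d A <= v) -> mu A <= v.
Proof. by move=> h; apply: ge_ereal_sup => _ [d /= d0 <-]; exact: h. Qed.

Lemma hausdorff_ge0 A : 0 <= mu A.
Proof. by apply: le_trans (hausdorff_pre_le_hausdorff A ltr01); exact: hausdorff_pre_ge0. Qed.

Lemma hausdorff0 : mu set0 = 0.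
Proof.
apply/eqP; rewrite eq_le hausdorff_ge0 andbT.
by apply: hausdorff_le => d _; rewrite hausdorff_pre0.
Qed.

Lemma le_hausdorff A B : A `<=` B -> mu A <= mu B.
Proof.
move=> AB; apply: hausdorff_le => d d0.
exact: le_trans (le_hausdorff_pre d AB) (hausdorff_pre_le_hausdorff B d0).
Qed.

Lemma hausdorff_sigma_subadditive (F : nat -> set V) :
  mu (\bigcup_j F j) <= \sum_(0 <= j <oo) mu (F j).
Proof.
apply: hausdorff_le => d d0; apply: le_trans (hausdorff_pre_sigma_subadditive d F) _.
apply: lee_nneseries => [j _ _|j _]; first exact: hausdorff_pre_ge0.
exact: hausdorff_pre_le_hausdorff.
Qed.

Lemma hausdorff_separated e A B : (0 < e)%R ->
  (forall a b, A a -> B b -> (e <= enorm (a - b))%R) ->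
  mu A + mu B <= mu (A `|` B).
Proof.
move=> e0 AB; have [->|Moo] := eqVneq (mu (A `|` B)) +oo; first exact: leey.
have fin C : C `<=` A `|` B -> mu C \is a fin_num.
  move=> /le_hausdorff CM; rewrite ge0_fin_numE ?hausdorff_ge0 //.
  by rewrite (le_lt_trans CM) // ltey.
have Mf : mu (A `|` B) \is a fin_num by exact: fin.
have Bf : mu B \is a fin_num by apply: fin => x; right.
rewrite -leeBrDr //; apply: hausdorff_le => d d0.
have Af : pre d A \is a fin_num.
  rewrite ge0_fin_numE ?hausdorff_pre_ge0 //.
  rewrite (le_lt_trans (hausdorff_pre_le_hausdorff A d0)) //.
  by rewrite -ge0_fin_numE ?hausdorff_ge0 //; apply: fin => x; left.
rewrite leeBrDr // addeC -leeBrDr //; apply: hausdorff_le => d' d'0.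
rewrite leeBrDr // addeC.
pose d0' : R := (Num.min (Num.min d d') (e / 2))%R.
have d0'0 : (0 < d0')%R by rewrite !lt_min d0 d'0 divr_gt0.
have d0'e : (d0' < e)%R.
  by rewrite gt_min [X in _ || X](_ : _ = true) ?orbT // ltr_pdivrMr // ltr_pMr // ltr1n.
apply: le_trans (hausdorff_pre_le_hausdorff (A `|` B) d0'0).
apply: le_trans (hausdorff_pre_separated d0'e AB).
by apply: leeD; apply: hausdorff_pre_anti; rewrite !ge_min lexx ?orbT.
Qed.

End HausdorffPremeasure.

HB.instance Definition _ (R : realType) (k n : nat) :=
  isOuterMeasure.Build R (borelRn R n) (@hausdorff R k.+1 n)
    hausdorff0 hausdorff_ge0 (@le_hausdorff R k n) hausdorff_sigma_subadditive.

Section HausdorffMeasure.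
Context {R : realType} {k n : nat}.
Local Notation V := 'rV[R]_n.
Local Notation mu := (@hausdorff R k.+1 n).
Local Open Scope ereal_scope.

(** Caratheodory's criterion.  Let A j be the inner parts of O and D j the part of
    X in the shell between A j and A (j + 1).  As D (j + 1) is at positive distance
    from A j, the measures of the shells have a finite sum if X has finite measure;
    so the part of X in O outside A j has small measure for large j.  What remains
    is additivity for the parts of X in A j and outside O, which are at positive
    distance from each other. *)
Lemma open_caratheodory (O : set V) : open O -> mu.-caratheodory O.
Proof.
move=> oO; apply: le_caratheodory_measurable => X.
have [Xoo|Xoo] := eqVneq (mu X) +oo; first by rewrite [X in _ <= X]Xoo leey.
pose A := inner_part O; pose r j : R := (j.+1%:R^-1)%R.
have AS i j : (i <= j)%N -> A i `<=` A j by exact: le_inner_part.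
have rS j : (r j.+1 < r j)%R by rewrite ltf_pV2 ?posrE ?ltr0n // ltr_nat.
have OA x : O x -> exists j, A j x by exact: inner_part_exhausts.
pose D j := X `&` (A j.+1 `\` A j).
have step j : mu (X `&` A j) + mu (D j.+1) <= mu (X `&` A j.+2).
  have e0 : (0 < r j - r j.+1)%R by rewrite subr_gt0.
  apply: le_trans (hausdorff_separated e0 _) _; last first.
    apply: le_hausdorff => x [[Xx Ax]|[Xx [Ax _]]]; split=> //.
    by apply: AS Ax; rewrite -addn2 leq_addr.
  move=> a b [_ Aa] [_ [_ /existsNP[y /not_implyP[Oy /negP]]]].
  rewrite -ltNge => yb; apply: le_trans (norm_le_enorm _).
  rewrite lerBlDr; apply: le_trans (Aa y Oy) _.
  rewrite -[(a - y)%R](subrKA b) (le_trans (ler_normD _ _)) // lerD2l.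
  exact: ltW.
(* Each term is absorbed by [step]; the sum runs through even and odd shells
   alternately, whence the two summands on the right. *)
have partial N : \sum_(0 <= j < N) mu (D j.+1) <= mu (X `&` A N) + mu (X `&` A N.+1).
  elim: N => [|N IH]; first by rewrite big_geq // adde_ge0 ?hausdorff_ge0.
  rewrite big_nat_recr //=; apply: le_trans (leeD IH (lexx _)) _.
  by rewrite (addeC (mu (X `&` A N))) -addeA; apply: leeD2l; exact: step.
have sumD : \sum_(0 <= j <oo) mu (D j.+1) < +oo.
  apply: (@le_lt_trans _ _ (mu X + mu X)); last by rewrite lte_add_pinfty // ltey.
  apply: lime_le; first by apply: is_cvg_nneseries => *; exact: hausdorff_ge0.
  apply: nearW => N; apply: le_trans (partial N) _.
  by apply: leeD; apply: le_hausdorff => x [].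
have tail0 := nneseries_tail_cvg sumD (fun j _ => hausdorff_ge0 (D j.+1)).
have cover N : X `&` O `<=` (X `&` A N.+1) `|` \bigcup_(j in ~` `I_N) D j.+1.
  move=> x [Xx /OA Ox]; have [Ax|nAx] := pselect (A N.+1 x); first by left.
  right; have [j Aj] := Ox; have {Ox} [d dE] : exists d, A (d + N.+1)%N x.
    by exists j; apply: AS Aj; rewrite leq_addr.
  elim: d dE => [//|d IH] dE; have [/IH //|ndE] := pselect (A (d + N.+1)%N x).
  exists (d + N)%N; first by apply/negP; rewrite -leqNgt leq_addl.
  by split=> //; move: dE ndE; rewrite addSn addnS; split.
apply/lee_addgt0Pr => e e0.
have [N hN] : exists N, \sum_(N <= j <oo) mu (D j.+1) <= e%:E.
  have he : nbhs (0 : \bar R) [set u | u < e%:E].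
    by apply: open_ereal_lt'; rewrite lte_fin.
  by have [N _ hN] := tail0 _ he; exists N; apply/ltW/hN => /=.
have h1 : mu (X `&` O) <= mu (X `&` A N.+1) + e%:E.
  apply: le_trans (le_hausdorff (cover N)) _.
  apply: le_trans (outer_measureU2 mu _ _) _; apply: leeD => //.
  exact: le_trans (outer_measure_sigma_subadditive_tail mu N (fun j => D j.+1)) hN.
have h2 : mu (X `&` A N.+1) + mu (X `&` ~` O) <= mu X.
  have r0 : (0 < r N.+1)%R by rewrite invr_gt0 ltr0n.
  apply: le_trans (hausdorff_separated r0 _) _; last first.
    by apply: le_hausdorff => x [[]|[]].
  move=> a b [_ Aa] [_ Ob]; apply: le_trans (norm_le_enorm _); exact: Aa.
apply: le_trans (leeD h1 (lexx _)) _.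
by rewrite addeAC leeD.
Qed.

Lemma borel_caratheodory (A : set (borelRn R n)) : measurable A -> mu.-caratheodory A.
Proof.
have sC : sigma_algebra setT mu.-caratheodory.
  split; first exact: caratheodory_measurable_set0.
    by move=> B mB; rewrite setTD; exact: caratheodory_measurable_setC.
  exact: caratheodory_measurable_bigcup.
apply: smallest_sub => // O oO; exact: open_caratheodory.
Qed.

Lemma hausdorff_semi_sigma_additive : semi_sigma_additive (mu : set (borelRn R n) -> \bar R).
Proof.
move=> F mF tF mUF.
apply: (@caratheodory_measure_sigma_additive R (borelRn R n) mu F) => //.
  by move=> i; exact: borel_caratheodory.
exact: borel_caratheodory.
Qed.

End HausdorffMeasure.

HB.instance Definition _ (R : realType) (k n : nat) :=
  isMeasure.Build _ (borelRn R n) R (@hausdorff R k.+1 n)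
    hausdorff0 hausdorff_ge0 hausdorff_semi_sigma_additive.

(** * Graphs have locally finite area *)

Section Lipschitz.
Context {R : realType} {m : nat}.
Local Notation V := 'rV[R]_m.
Implicit Types (f : V -> R) (x y z w v : V).

Lemma is_derive_line f v w s : derivable f (s *: v + w) v ->
  is_derive s 1 (fun t : R => f (t *: v + w)) ('D_v f (s *: v + w)).
Proof.
move=> df; set F := fun t : R => f (t *: v + w).
have E : (fun h : R => h^-1 *: ((F \o shift s) (h *: 1) - F s)) =
    (fun h : R => h^-1 *: ((f \o shift (s *: v + w)) (h *: v) - f (s *: v + w))).
  by apply/funext => h; rewrite /F /= [_ *: 1]mulr1 scalerDl addrA.
by apply: DeriveDef; [rewrite /derivable E|rewrite /derive E].
Qed.

Lemma line_lipschitz f i w M (a b : R) : a <= b ->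
  (forall s, a <= s <= b -> derivable f (s *: delta_mx 0 i + w) (delta_mx 0 i) /\
     `|partial i f (s *: delta_mx 0 i + w)| <= M) ->
  `|f (b *: delta_mx 0 i + w) - f (a *: delta_mx 0 i + w)| <= M * (b - a).
Proof.
move=> ab h.
pose F (t : R) := f (t *: delta_mx 0 i + w).
have dF s : a <= s <= b -> is_derive s 1 F (partial i f (s *: delta_mx 0 i + w)).
  by move=> /h[h1 _]; exact: is_derive_line.
have [||s sab ->] := @MVT_segment R F
    (fun s => partial i f (s *: delta_mx 0 i + w)) a b ab.
- by move=> s sab; apply: dF; move: sab; rewrite in_itv /= => /andP[/ltW-> /ltW->].
- apply: derivable_within_continuous => s sab.
  by apply: (dF s _).(ex_derive); move: sab; rewrite in_itv.
rewrite normrM (ger0_norm (x := b - a)) ?subr_ge0 //.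
by rewrite ler_wpM2r ?subr_ge0 //; apply: (h s _).2; move: sab; rewrite in_itv.
Qed.

(** Moving one coordinate at a time, and applying the mean value theorem to each
    move, bounds the increment of [f] by the partial derivatives on the box. *)
Lemma box_lipschitz f x r M : 0 <= M ->
  (forall y, `|y - x| <= r -> forall i,
     derivable f y (delta_mx 0 i) /\ `|partial i f y| <= M) ->
  forall y z, `|y - x| <= r -> `|z - x| <= r -> `|f z - f y| <= m%:R * M * `|z - y|.
Proof.
move=> M0 h y z yr zr; have r0 : 0 <= r by apply: le_trans yr.
pose p (j : nat) : V := \row_i (if (i < j)%N then z 0 i else y 0 i).
have p0 : p 0%N = y by apply/rowP => i; rewrite mxE.
have pm : p m = z by apply/rowP => i; rewrite mxE ltn_ord.
have coordyx i : `|y 0 i - x 0 i| <= r by have /rV_norm_leP /(_ i) := yr; rewrite !mxE; apply.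
have coordzx i : `|z 0 i - x 0 i| <= r by have /rV_norm_leP /(_ i) := zr; rewrite !mxE; apply.
have step j : (j < m)%N -> `|f (p j.+1) - f (p j)| <= M * `|z - y|.
  move=> jm; pose i : 'I_m := Ordinal jm.
  (* the line through p j and p (j + 1) is that of direction i through w *)
  pose w : V := \row_l (if l == i then 0 else p j 0 l).
  have pE t : (t = z 0 i -> t *: delta_mx 0 i + w = p j.+1) /\
              (t = y 0 i -> t *: delta_mx 0 i + w = p j).
    split=> ->; apply/rowP => l; rewrite !mxE eqxx /=; case: (eqVneq l i) => [->|li].
    - by rewrite /= ltnSn mulr1 addr0.
    - by rewrite mulr0 add0r ltnS [in RHS]leq_eqVlt (_ : (l == j :> nat) = false) //; apply/negbTE.
    - by rewrite /= ltnn mulr1 addr0.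
    - by rewrite mulr0 add0r.
  have seg a b s : `|a - x 0 i| <= r -> `|b - x 0 i| <= r -> a <= s <= b ->
      `|s *: delta_mx 0 i + w - x| <= r.
    move=> ar br /andP[as_ sb]; apply/rV_norm_leP => // l; rewrite !mxE eqxx /=.
    case: (eqVneq l i) => [->|li].
      rewrite mulr1 addr0; move: ar br; rewrite !ler_norml; lra.
    by rewrite mulr0 add0r; case: ifP.
  have zy : `|z 0 i - y 0 i| <= `|z - y|.
    by have /rV_norm_leP /(_ i) := lexx `|z - y|; rewrite !mxE; apply.
  rewrite -((pE _).1 erefl) -((pE _).2 erefl).
  apply: le_trans (_ : M * `|z 0 i - y 0 i| <= _); last by rewrite ler_wpM2l.
  have [yz|/ltW zy'] := leP (y 0 i) (z 0 i).
    rewrite [X in M * X]ger0_norm ?subr_ge0 //; apply: line_lipschitz => // s sI.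
    by apply: h; apply: seg sI.
  rewrite distrC [X in M * X]distrC [X in M * X]ger0_norm ?subr_ge0 //.
  apply: line_lipschitz => // s sI.
  by apply: h; apply: seg sI.
have tele j : (j <= m)%N -> `|f (p j) - f y| <= j%:R * M * `|z - y|.
  elim: j => [|j IH] jm; first by rewrite p0 subrr normr0 !mul0r.
  rewrite -(subrKA (f (p j))) (le_trans (ler_normD _ _)) //.
  by rewrite -natr1 mulrDl mul1r mulrDl addrC lerD // ?step // IH // ltnW.
by have := tele m (leqnn m); rewrite pm.
Qed.

Lemma Ck1_locally_lipschitz (U : set V) f x : open U -> Ck 1 U f -> U x ->
  exists r L, [/\ 0 < r, 0 <= L, forall y, `|y - x| <= r -> U y &
    forall y z, `|y - x| <= r -> `|z - x| <= r -> `|f z - f y| <= L * `|z - y|].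
Proof.
move=> oU fU Ux; pose M := \sum_i (`|partial i f x| + 1).
have Mi i : `|partial i f x| + 1 <= M.
  by rewrite /M (bigD1 i) //= lerDl sumr_ge0 // => j _; rewrite addr_ge0.
have M0 : 0 <= M by apply: sumr_ge0 => j _; rewrite addr_ge0.
have near_x : \forall y \near x, U y /\ forall i, `|partial i f y| <= M.
  have h1 : \forall y \near x, U y by exact: open_nbhs_nbhs.
  have h2i i : \forall y \near x, `|partial i f y| <= M.
    have cp : {for x, continuous (partial i f)} := (fU.2 i).2.1 x Ux.
    have h : `|partial i f x| < `|partial i f x| + 1 by rewrite ltrDl.
    have hn := cvgr_norm_lt (partial i f x) cp _ h.
    by near=> y; apply: le_trans (Mi i); apply: ltW; near: y; exact: hn.
  have h2 : \forall y \near x, forall i, `|partial i f y| <= M.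
    exact: (@filter_forall _ _ (fun i y => is_true (`|partial i f y| <= M)) (nbhs x) _ h2i).
  by near=> y; split; near: y.
have /nbhs_ballP[e /= e0 eh] := near_x.
have e2 : e / 2 < e by rewrite ltr_pdivrMr // ltr_pMr // ltr1n.
have bh y : `|y - x| <= e / 2 -> U y /\ forall i, `|partial i f y| <= M.
  by move=> yx; apply: eh; rewrite -ball_normE /ball_ /= distrC (le_lt_trans yx).
exists (e / 2), (m%:R * M); split; [by rewrite divr_gt0|by rewrite mulr_ge0| |].
  by move=> y /bh[].
apply: box_lipschitz => // y /bh[Uy My] i; split=> //.
exact: (fU.2 i).1.
Unshelve. all: by end_near. Qed.

End Lipschitz.

Section GraphArea.
Context {R : realType}.

Lemma diam_le (n : nat) (F : set 'rV[R]_n) delta :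
  (forall x y, F x -> F y -> enorm (x - y) <= delta) -> (diam F <= delta%:E)%E.
Proof.
by move=> h; apply: ge_ereal_sup => _ [[x y] /= [Fx Fy] <-]; rewrite lee_fin; exact: h.
Qed.

Lemma ball_volume_le (k n : nat) (F : set 'rV[R]_n) delta : 0 <= delta ->
  (diam F <= delta%:E)%E ->
  (ball_volume (k := k) F <= (unit_ball_volume k.+1 * (delta / 2) ^+ k.+1)%:E)%E.
Proof.
move=> delta0 dF; rewrite lee_fin ler_wpM2l ?unit_ball_volume_ge0 //.
rewrite lerXn2r ?nnegrE ?divr_ge0 ?fine_diam_ge0 // ler_wpM2r ?invr_ge0 //.
have [->|/set0P[x Fx]] := eqVneq F set0; first by rewrite diam_set0.
have d0 : (0 <= diam F)%E.
  by apply: le_trans (enorm_le_diam Fx Fx); rewrite lee_fin sqrtr_ge0.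
by rewrite -lee_fin fineK // ge0_fin_numE // (le_lt_trans dF) // ltry.
Qed.

(** Finite covers, indexed by any finite type, are padded with empty sets. *)
Lemma hausdorff_pre_finite_cover (k n : nat) d (A : set 'rV[R]_n) (I : finType)
    (F : I -> set 'rV[R]_n) delta : 0 <= delta <= d ->
  (forall i, diam (F i) <= delta%:E)%E -> A `<=` \bigcup_i F i ->
  (hausdorff_pre k.+1 d A <=
     (#|I|%:R * (unit_ball_volume k.+1 * (delta / 2) ^+ k.+1))%:E)%E.
Proof.
move=> /andP[delta0 deltad] dF AF.
pose G j := if insub j is Some i then F (enum_val (i : 'I_#|I|)) else set0.
set b := unit_ball_volume k.+1 * _.
have b0 : 0 <= b by rewrite mulr_ge0 ?unit_ball_volume_ge0 // exprn_ge0 // divr_ge0.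
have dG j : (diam (G j) <= delta%:E)%E.
  by rewrite /G; case: insubP => // _; rewrite diam_set0 leNye.
apply: le_trans (hausdorff_pre_le (F := G) _ _) _.
- by move=> j; apply: le_trans (dG j) _; rewrite lee_fin.
- move=> x /AF[i _ Fix]; exists (enum_rank i) => //.
  by rewrite /G valK enum_rankK.
apply: lime_le; first by apply: is_cvg_nneseries => *; exact: ball_volume_ge0.
apply: nearW => N.
have : (\sum_(0 <= j < N) ball_volume (k := k) (G j) <= ((minn N #|I|)%:R * b)%:E)%E.
  elim: N => [|N IH]; first by rewrite big_geq // min0n mul0r.
  rewrite big_nat_recr //=; have [NI|NI] := ltnP N #|I|.
    rewrite (minn_idPl NI) -natr1 mulrDl mul1r EFinD; apply: leeD.
      by move: IH; rewrite (minn_idPl (ltnW NI)).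
    exact: ball_volume_le.
  rewrite (_ : G N = set0) ?ball_volume0 ?adde0; last first.
    by rewrite /G insubN // -leqNgt.
  by move: IH; rewrite !(minn_idPr _) // ltnW.
move/le_trans; apply; rewrite lee_fin ler_wpM2r // ler_nat.
exact: geq_minr.
Qed.

(** Cutting the cube into N^(k+1) subcubes covers its image by as many sets of
    diameter O(1/N); so all the premeasures are bounded by the same number. *)
Lemma hausdorff_lipschitz_cube (k n : nat) (G : 'rV[R]_k.+1 -> 'rV[R]_n)
    (x : 'rV[R]_k.+1) (r L : R) :
  0 < r -> 0 <= L ->
  (forall y z, `|y - x| <= r -> `|z - x| <= r -> `|G z - G y| <= L * `|z - y|) ->
  (hausdorff k.+1 n (G @` [set y | (`|y - x| < r)%R] : set (borelRn R n)) < +oo)%E.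
Proof.
move=> r0 L0 GL; pose c : R := Num.sqrt n%:R * (L * (2 * r)).
have c0 : 0 <= c by rewrite !mulr_ge0 ?sqrtr_ge0 // ltW.
apply: (@le_lt_trans _ _ (unit_ball_volume k.+1 * (c / 2) ^+ k.+1)%:E); last exact: ltry.
apply: hausdorff_le => d d0.
pose N := (Num.truncn (c / d)).+1.
have N0 : (0 : R) < N%:R by rewrite ltr0n.
have cN : c / N%:R <= d.
  rewrite ler_pdivrMr // -ler_pdivrMl // mulrC ltW //.
  exact: Num.Theory.truncnS_gt.
pose I := {ffun 'I_k.+1 -> 'I_N}.
(* the lower end of the a-th of the N subintervals of ]x_i - r, x_i + r[ *)
pose lo (i : 'I_k.+1) (a : nat) : R := x 0 i - r + a%:R * (2 * r / N%:R).
pose cell (a : I) : set 'rV[R]_k.+1 :=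
  [set y | `|y - x| < r /\ forall i, lo i (a i) <= y 0 i <= lo i (a i).+1].
(* This equality is why the bound does not depend on N: there are N^(k+1) cells,
   and the volume of a ball of dimension k + 1 scales like N^-(k+1). *)
have -> : unit_ball_volume k.+1 * (c / 2) ^+ k.+1 =
    #|{: I}|%:R * (unit_ball_volume k.+1 * ((c / N%:R) / 2) ^+ k.+1).
  rewrite card_ffun !card_ord natrX mulrCA -exprMn; congr (_ * _ ^+ _).
  by field; rewrite pnatr_eq0.
apply: (@hausdorff_pre_finite_cover _ _ _ _ _ (fun a => G @` cell a)).
- by rewrite cN divr_ge0.
- move=> a; apply: diam_le => _ _ [y [yr ya] <-] [z [zr za] <-].
  apply: le_trans (enorm_le_norm _) _; rewrite /c -!mulrA ler_wpM2l ?sqrtr_ge0 //.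
  apply: le_trans (GL _ _ _ _) _; [exact: ltW|exact: ltW|rewrite ler_wpM2l //].
  apply/rV_norm_leP => [|i]; first by rewrite mulrA divr_ge0 ?mulr_ge0 // ltW.
  rewrite mulrA !mxE ler_norml; have := ya i; have := za i.
  rewrite /lo -natr1 mulrDl mul1r.
  move: (2 * r / N%:R) => u; lra.
- move=> _ [y yr <-]; have r2 : 0 < 2 * r by rewrite mulr_gt0.
  pose t i := (y 0 i - x 0 i + r) * N%:R / (2 * r).
  have coord i : `|y 0 i - x 0 i| < r.
    apply: le_lt_trans yr; have /rV_norm_leP /(_ i) := lexx `|y - x|.
    by rewrite !mxE; apply.
  have t0 i : 0 <= t i.
    rewrite divr_ge0 ?(ltW r2) // mulr_ge0 //.
    by have := coord i; rewrite ltr_norml => /andP[]; lra.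
  have tN i : (Num.truncn (t i) < N)%N.
    rewrite Num.Theory.truncn_lt_nat // /t ltr_pdivrMr // [ltRHS]mulrC ltr_pM2r //.
    by have := coord i; rewrite ltr_norml => /andP[]; lra.
  exists [ffun i => Ordinal (tN i)] => //; exists y => //; split=> // l.
  rewrite ffunE /= /lo; have /andP[] := Num.Theory.truncn_itv (t0 l).
  have -> : y 0 l = x 0 l - r + t l * (2 * r / N%:R).
    rewrite /t; field; rewrite pnatr_eq0 /= ?gt_eqF //.
  have h : 0 <= 2 * r / N%:R by rewrite divr_ge0 // ltW.
  by move=> h1 h2; rewrite !lerD2l !ler_wpM2r // ltW.
Qed.

Lemma norm_lsubmx_le (n1 n2 : nat) (p : 'rV[R]_(n1 + n2)) : `|lsubmx p| <= `|p|.
Proof.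
by apply/rV_norm_leP => // i; rewrite mxE; have /rV_norm_leP := lexx `|p|; apply.
Qed.

Lemma graph_locally_finite (k : nat) (U : set 'rV[R]_k.+1) f (K : set 'rV[R]_(k.+1 + 1)) :
  open U -> Ck 1 U f -> compact K -> K `<=` cylinder U ->
  (hausdorff k.+1 (k.+1 + 1) (graph U f `&` K : set (borelRn R (k.+1 + 1))) < +oo)%E.
Proof.
move=> oU fU cK KU; move: cK.
apply: (@compact_ind _ (fun A => (hausdorff k.+1 (k.+1 + 1) (graph U f `&` A : set (borelRn R (k.+1 + 1))) < +oo)%E)).
- by rewrite setI0 hausdorff0.
- move=> A B fA fB; rewrite setIUr.
  apply: le_lt_trans (outer_measureU2 (@hausdorff R k.+1 (k.+1 + 1)) _ _) _.
  exact: lte_add_pinfty.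
- by move=> A B AB; apply: le_lt_trans; apply: le_hausdorff; exact: setIS.
move=> p /KU Up; have [r [L [r0 L0 rU fL]]] := Ck1_locally_lipschitz oU fU Up.
exists [set q | `|lsubmx q - lsubmx p| < r].
  apply/nbhs_ballP; exists r => //= q; rewrite -ball_normE /ball_ /= distrC => qp.
  by apply: le_lt_trans qp; rewrite -linearB; exact: norm_lsubmx_le.
pose G (y : 'rV[R]_k.+1) : 'rV[R]_(k.+1 + 1) := row_mx y (const_mx (f y)).
apply: le_lt_trans (@hausdorff_lipschitz_cube k _ G (lsubmx p) r (1 + L) r0 _ _).
- apply: le_hausdorff => q [[Uq qf] qr]; exists (lsubmx q) => //.
  rewrite /G -[RHS]hsubmxK; congr row_mx; apply/rowP => i.
  by rewrite (ord1 i) mxE -qf.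
- by rewrite addr_ge0.
move=> y z yr zr; apply/rV_norm_leP => [|i]; first by rewrite mulr_ge0 // addr_ge0.
rewrite !mxE mulrDl mul1r; case: splitP => j _.
  have /rV_norm_leP /(_ j) := lexx `|z - y|; rewrite !mxE => /(_ (normr_ge0 _)) h.
  by apply: le_trans h _; rewrite lerDl mulr_ge0.
by rewrite !mxE; apply: le_trans (fL _ _ yr zr) _; rewrite lerDr.
Qed.

End GraphArea.

(** * The calibrating field *)

Section Calibration.
Context {R : realType} {m : nat}.
Local Notation E := 'rV[R]_(m + 1).
Implicit Types (U : set 'rV[R]_m) (W : set E) (p q v : E) (f : 'rV[R]_m -> R) (F : E -> R).

Lemma derive_vertical_invariant F p q v :
  (forall x y, lsubmx x = lsubmx y -> F x = F y) -> lsubmx p = lsubmx q ->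
  'D_v F p = 'D_v F q.
Proof.
move=> hF pq; rewrite /derive.
suff -> : (fun h : R => h^-1 *: ((F \o shift p) (h *: v) - F p)) =
    (fun h : R => h^-1 *: ((F \o shift q) (h *: v) - F q)) by [].
by apply/funext => h /=; congr (_ *: (_ - _)); apply: hF; rewrite // !linearD /= pq.
Qed.

Lemma is_derive_lsubmx f p v df : is_derive (lsubmx p) (lsubmx v) f df ->
  is_derive p v (fun q => f (lsubmx q)) df.
Proof.
have e : (fun h : R => h^-1 *: (((fun q : E => f (lsubmx q)) \o shift p) (h *: v) - f (lsubmx p))) =
    (fun h : R => h^-1 *: ((f \o shift (lsubmx p)) (h *: lsubmx v) - f (lsubmx p))).
  by apply/funext => h /=; congr (_ *: (f _ - _)); apply/rowP => i; rewrite !mxE.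
by move=> [df1 <-]; apply: DeriveDef; [rewrite /derivable e|rewrite /derive e].
Qed.

Lemma open_cylinder U : open U -> open (cylinder U : set E).
Proof. by move=> oU; apply: open_comp => // p _; exact: continuous_lsubmx. Qed.

Lemma Ck_lsubmx k U f : open U -> Ck k U f ->
  Ck k (cylinder U) (fun p : E => f (lsubmx p)).
Proof.
move=> oU; have oC := open_cylinder oU.
have cont (g : 'rV[R]_m -> R) p : (forall x, U x -> {for x, continuous g}) -> cylinder U p ->
    {for p, continuous (fun q : E => g (lsubmx q))}.
  move=> gc Up; have h1 := @continuous_lsubmx R 1 m 1 p; have h2 := gc _ Up.
  exact: (continuous_comp h1 h2).
elim: k f => [|k IH] f hf.
  by split=> // p Up; apply: cont => // x; exact: (Ck_continuous hf).
pose df (i : 'I_(m + 1)) : E -> R :=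
  match fintype.split i with inl j => fun q => partial j f (lsubmx q) | inr _ => cst 0 end.
apply: (@CkS _ _ _ _ _ df) => //.
- by move=> p Up; apply: cont => // x; exact: (Ck_continuous hf).
- move=> i p Up; apply: is_derive_lsubmx; rewrite /df.
  case: splitP => j ij.
    have -> : i = lshift 1 j by exact: val_inj.
    have -> : lsubmx (delta_mx 0 (lshift 1 j) : E) = delta_mx 0 j.
      by apply/rowP => l; rewrite !mxE eq_lshift.
    exact: Ck_is_derive hf Up.
  have -> : i = rshift m j by exact: val_inj.
  have -> : lsubmx (delta_mx 0 (rshift m j) : E) = 0.
    by apply/rowP => l; rewrite !mxE eq_lrshift.
  exact: is_derive0.
- move=> i; rewrite /df; case: splitP => j _; last exact: Ck_cst.
  by apply: IH; apply: (hf.2 j).2.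
Qed.

Lemma Ck_setU k W W' F : Ck k W F -> Ck k W' F -> Ck k (W `|` W') F.
Proof.
elim: k F => [|k IH] F [c d] [c' d']; split=> //; try by move=> x [/c|/c'].
move=> i; split; first by move=> x [/(d i).1|/(d' i).1].
by apply: IH; [exact: (d i).2|exact: (d' i).2].
Qed.

Lemma dot_graph_normal f p : dot (graph_normal f p) (graph_normal f p) = 1.
Proof.
rewrite /graph_normal; set g := grad f _; set s := Num.sqrt _.
have g0 : 0 < 1 + dot g g by rewrite ltr_pwDl // dot_ge0.
have s2 : s * s = 1 + dot g g by rewrite -expr2 sqr_sqrtr // ltW.
rewrite /dot big_split_ord /= big_ord_recl big_ord0 addr0.
under eq_bigr => i _ do rewrite !mxE (unsplitK (inl i)) !mxE.
rewrite !mxE (unsplitK (inr ord0)) !mxE mulr1.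
have -> : \sum_(i < m) s^-1 * - partial i f (lsubmx p) * (s^-1 * - partial i f (lsubmx p)) =
    s^-1 * s^-1 * dot g g.
  by rewrite /dot mulr_sumr; apply: eq_bigr => i _; rewrite !mxE; ring.
rewrite -[X in _ + X]mulr1 -mulrDr -invfM [dot g g + 1]addrC s2 mulVf // gt_eqF //.
Qed.

Lemma Ck_graph_normal k U f i : open U -> Ck k.+1 U f ->
  Ck k (cylinder U) (fun p => graph_normal f p 0 i).
Proof.
move=> oU fU; have oC := open_cylinder oU.
have gC j : Ck k (cylinder U) (fun p : E => partial j f (lsubmx p)).
  by apply: Ck_lsubmx => //; apply: (fU.2 j).2.
pose nrm (p : E) := Num.sqrt (1 + \sum_(j < m) partial j f (lsubmx p) * partial j f (lsubmx p)).
have pos (p : E) : 0 < 1 + \sum_(j < m) partial j f (lsubmx p) * partial j f (lsubmx p).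
  by rewrite ltr_pwDl // sumr_ge0 // => j _; rewrite -expr2 sqr_ge0.
have nC : Ck k (cylinder U) (fun p => (nrm p)^-1).
  apply: Ck_inv => //; first by move=> p _; rewrite sqrtr_gt0.
  apply: Ck_sqrt => //; apply: CkD => //; first exact: Ck_cst.
  by apply: Ck_sum => // j; apply: CkM.
have nE p : Num.sqrt (1 + dot (grad f (lsubmx p)) (grad f (lsubmx p))) = nrm p.
  by rewrite /nrm /dot; congr (Num.sqrt (1 + _)); apply: eq_bigr => j _; rewrite !mxE.
case: (split_ordP i) => j ->.
  apply: (@Ck_eq _ _ _ _ (fun p => (nrm p)^-1 * - partial j f (lsubmx p))) => //.
    by move=> p _; rewrite /graph_normal nE !mxE (unsplitK (inl j)) !mxE.
  by apply: CkM => //; exact: CkN.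
apply: (@Ck_eq _ _ _ _ (fun p => (nrm p)^-1)) => //.
by move=> p _; rewrite /graph_normal nE !mxE (unsplitK (inr j)) !mxE mulr1.
Qed.

(** The calibrating field: its length is the density, and it is normal to the
    graph and to all vertical translates of the graph. *)
Definition weighted_normal (psi : E -> R) f (p : E) : E := expR (psi p) *: graph_normal f p.

Lemma Ck_weighted_normal k U psi f i : open U -> Ck k (cylinder U) psi ->
  Ck k.+1 U f -> Ck k (cylinder U) (fun p => weighted_normal psi f p 0 i).
Proof.
move=> oU hpsi hf; have oC := open_cylinder oU.
apply: (@Ck_eq _ _ _ _ (fun p => expR (psi p) * graph_normal f p 0 i)) => //.
  by move=> p _; rewrite [RHS]mxE.
by apply: CkM => //; [exact: Ck_expR|exact: Ck_graph_normal].
Qed.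

(** The divergence is e^psi (div n + <grad psi, n>).  The bracket does not depend
    on the last coordinate, and on the graph it is - m times the weighted mean
    curvature. *)
Lemma div_weighted_normal U psi f p : open U -> (0 < m)%N ->
  (forall x y, lsubmx x = lsubmx y -> psi x = psi y) ->
  Ck 1 (cylinder U) psi -> Ck 2 U f -> weighted_minimal U psi f ->
  cylinder U p -> div (weighted_normal psi f) p = 0.
Proof.
move=> oU m0 psiv hpsi hf hmin Up.
have -> : div (weighted_normal psi f) p =
    expR (psi p) * (div (graph_normal f) p + dot (grad psi p) (graph_normal f p)).
  rewrite mulrDr /div /dot !mulr_sumr -big_split; apply: eq_bigr => i _ /=.
  have hn : is_derive p (delta_mx 0 i) (fun q => graph_normal f q 0 i)
      (partial i (fun q => graph_normal f q 0 i) p).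
    exact: (Ck_is_derive i (Ck_graph_normal i oU hf) Up).
  have he : is_derive p (delta_mx 0 i) (fun q => expR (psi q)) (expR (psi p) * partial i psi p).
    exact: (is_derive_comp1 (Ck_is_derive i hpsi Up) (is_derive_expR (psi p))).
  rewrite /partial (_ : (fun y => weighted_normal psi f y 0 i) =
    (fun y => expR (psi y) * graph_normal f y 0 i)).
    by rewrite (is_derive_mul he hn).(derive_val) [grad psi p 0 i]mxE /partial; ring.
  by apply/funext => y; rewrite [LHS]mxE.
pose q : E := row_mx (lsubmx p) (const_mx (f (lsubmx p))).
have qp : lsubmx q = lsubmx p by rewrite row_mxKl.
have gq : graph U f q by split; rewrite /= qp // row_mxKr mxE.
have ndiv : div (graph_normal f) q = div (graph_normal f) p.
  apply: eq_bigr => i _; apply: derive_vertical_invariant => // x y xy.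
  by rewrite /graph_normal xy.
have npsi : grad psi q = grad psi p.
  by apply/rowP => i; rewrite !mxE; exact: derive_vertical_invariant.
have nn : graph_normal f q = graph_normal f p by rewrite /graph_normal qp.
have := hmin q gq; rewrite /weighted_mean_curvature /mean_curvature ndiv npsi nn.
have mn0 : m%:R != 0 :> R by rewrite pnatr_eq0 -lt0n.
move=> /(congr1 (fun t => - m%:R * t)); rewrite mulr0.
rewrite (_ : - m%:R * _ = div (graph_normal f) p + dot (grad psi p) (graph_normal f p)).
  by move=> ->; rewrite mulr0.
by field.
Qed.

(** Off the support of [chi] the product is 0, whatever the junk values of
    [weighted_normal] off the cylinder; that complement and the cylinder are open
    and cover the space. *)
Lemma test_field_cutoff U psi f A chi : open U -> smooth (cylinder U) psi ->
  smooth U f -> cutoff (cylinder U) A chi ->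
  test_field (cylinder U) (fun p => chi p *: weighted_normal psi f p).
Proof.
move=> oU hpsi hf [chiC _ [K [cK KU chi0]] _]; split; last first.
  by exists K; split=> // p /chi0 ->; rewrite scale0r.
move=> i k; have oC := open_cylinder oU.
have oK : open (~` K).
  by apply: closed_openC; apply: compact_closed cK; exact: norm_hausdorff.
apply: (@Ck_subset _ _ _ (cylinder U `|` ~` K)).
  by move=> p _; have [/KU|] := pselect (K p); [left|right].
apply: Ck_setU.
  apply: (@Ck_eq _ _ _ _ (fun p => chi p * weighted_normal psi f p 0 i)) => //.
    by move=> p _; rewrite [RHS]mxE.
  apply: CkM => //; last exact: Ck_weighted_normal.
  exact: Ck_subset (chiC k).
apply: (@Ck_eq _ _ _ _ (cst 0)) => //; last exact: Ck_cst.
by move=> p /chi0 h; rewrite [RHS]mxE h mul0r.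
Qed.

Lemma div_near_eq (X Y : E -> E) p : (\near p, X p = Y p) -> div X p = div Y p.
Proof.
move=> XY; apply: eq_bigr => i _.
have h : \near p, X p 0 i = Y p 0 i by near=> q; suff -> : X q = Y q by []; near: q.
exact: (near_eq_derive _ h).
Unshelve. all: by end_near. Qed.

End Calibration.

(** * Weighted areas as integrals *)

Section BorelMeasurability.
Context {R : realType} {n : nat}.
Local Notation V := 'rV[R]_n.
Local Notation B := (borelRn R n).

Lemma open_borel (O : set V) : open O -> measurable (O : set B).
Proof. by move=> oO; exact: sub_sigma_algebra. Qed.

Lemma closed_borel (C : set V) : closed C -> measurable (C : set B).
Proof.
by move=> cC; rewrite -[C]setCK; apply: measurableC; apply: open_borel; exact: closed_openC.
Qed.

Lemma compact_borel (K : set V) : compact K -> measurable (K : set B).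
Proof.
by move=> cK; apply: closed_borel; apply: compact_closed cK; exact: norm_hausdorff.
Qed.

Lemma continuous_borel (g : V -> R) (D : set B) : continuous g -> measurable_fun D (g : B -> R).
Proof.
move=> gc; apply: (@measurable_funTS _ _ B R) => mD.
apply: (measurability _ (RGenOInfty.measurableE R)) => // _ [_ [x ->] <-].
rewrite setTI set_itvoy; apply: open_borel.
by apply: open_comp => [y _|]; [exact: gc|exact: open_gt].
Qed.

Lemma nat_measurable_fun (D : set B) (h : B -> nat) :
  measurable_fun D h -> measurable_fun D (fun x => (h x)%:R : R).
Proof. by move=> mh; apply: (@measurableT_comp _ _ _ _ _ _ (fun j : nat => j%:R : R)). Qed.

End BorelMeasurability.

(** The graph is relatively closed in the open cylinder. *)
Lemma graph_borel (R : realType) (m : nat) (U : set 'rV[R]_m) f : open U -> Ck 0 U f ->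
  measurable (graph U f : set (borelRn R (m + 1))).
Proof.
move=> oU fU; have oC := @open_cylinder R m U oU.
pose h (q : 'rV[R]_(m + 1)) := q 0 (rshift m ord0) - f (lsubmx q).
have hC : Ck 0 (cylinder U) h.
  by apply: CkD => //; [exact: Ck_coord|apply: CkN => //; exact: Ck_lsubmx].
pose O : set 'rV[R]_(m + 1) := [set q | cylinder U q /\ h q != 0].
have oO : open O.
  move=> q [Uq hq]; have hc : {for q, continuous h} := Ck_continuous hC Uq.
  have h1 : \forall p \near q, cylinder U p by exact: open_nbhs_nbhs.
  have h2 : \forall p \near q, h p != 0 by exact: (cvgr_neq0 (h q) hc hq).
  by near=> p; split; near: p.
have -> : graph U f = cylinder U `\` O.
  apply/seteqP; split=> q.
    move=> [Uq fq]; split=> // -[_ /eqP]; apply; rewrite /h -fq !mxE.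
    by rewrite subrr.
  move=> [Uq nO]; split=> //; apply: contrapT => fq; apply: nO; split=> //.
  by apply/eqP => /subr0_eq h0; apply: fq; rewrite -h0 mxE.
by apply: measurableD; exact: open_borel.
Unshelve. all: by end_near. Qed.

(** The integral is by definition a difference x - x of extended reals, whose
    finite part is 0 also for infinite x; so [mu] may be any set function, such as
    [lebesgue]. *)
Lemma fine_integral0 d (T : measurableType d) (R : realType) (mu : set T -> \bar R) (g : T -> R) :
  (forall x, g x = 0) -> fine (\int[mu]_(x in [set: T]) (g x)%:E)%E = 0.
Proof.
move=> g0; have -> : (fun x => (g x)%:E) = cst 0%E by apply/funext => x; rewrite g0.
rewrite /integral.
have -> : ((cst 0%E \_ [set: T]) ^\-)%E = ((cst 0%E \_ [set: T]) ^\+)%E :> (T -> \bar R).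
  by apply/funext => x; rewrite funenegE funeposE patchE in_setT /cst oppe0.
by move: (ereal_sup _) => [r| |] //=; rewrite subrr.
Qed.

Section WeightedIntegrals.
Context {R : realType} {k : nat}.
Local Notation E := 'rV[R]_(k.+1 + 1).
Local Notation B := (borelRn R (k.+1 + 1)).
Local Notation mu := (@hausdorff R k.+1 (k.+1 + 1)).
Local Open Scope ereal_scope.
Implicit Types (W C K A : set E) (h : E -> nat) (psi chi : E -> R).

(** What the integration theory uses of a hypersurface in W with carrier C and
    multiplicity h. *)
Definition locally_finite_on W C h : Prop :=
  [/\ measurable (C : set B), measurable_fun (C : set B) (h : B -> nat)
    & forall K, compact K -> K `<=` W -> \int[mu]_(x in (C `&` K : set B)) ((h x)%:R)%:E < +oo].

Lemma locally_finite_graph (U : set 'rV[R]_k.+1) f : open U -> Ck 1 U f ->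
  locally_finite_on (cylinder U) (graph U f) (fun=> 1%N).
Proof.
move=> oU fU; have mG := graph_borel oU (Ck_pred fU); split=> // K cK KU.
rewrite (@integral_cst _ _ _ mu _ _ 1%:E) ?mul1e; first exact: graph_locally_finite.
by apply: measurableI => //; exact: compact_borel.
Qed.

Lemma weighted_measurable C h (u : E -> R) (D : set B) : D `<=` C ->
  measurable (C : set B) -> measurable_fun (C : set B) (h : B -> nat) -> continuous u ->
  measurable_fun D (fun x : B => ((h x)%:R * u x)%:E : \bar R).
Proof.
move=> DC mC mh uc; apply/measurable_EFinP; apply: measurable_funM.
  by apply: measurable_funS DC _ => //; exact: nat_measurable_fun.
exact: continuous_borel.
Qed.

(** A continuous weight of compact support is bounded, so the integral is at most
    a multiple of the mass in the support. *)
Lemma weighted_integrable W C h (u : E -> R) K : locally_finite_on W C h ->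
  continuous u -> compact K -> K `<=` W -> (forall x, ~ K x -> u x = 0%R) ->
  mu.-integrable C (fun x : B => ((h x)%:R * u x)%:E).
Proof.
move=> [mC mh hfin] uc cK KW uK.
have mK := compact_borel cK.
have [M M0 uM] : exists2 M : R, (0 <= M)%R & forall x, K x -> (`|u x| <= M)%R.
  have [K0|/set0P Kn0] := eqVneq K set0; first by exists 0%R => // x; rewrite K0.
  have uc' : {within K, continuous (fun x => `|u x|%R)}.
    apply: continuous_subspaceT => x; apply: (continuous_comp (uc x)).
    exact: norm_continuous.
  have [c _ hc] := EVT_max_rV Kn0 cK uc'.
  exists `|u c|%R => // x Kx; apply: hc; exact/mem_set.
have mf : measurable_fun (C : set B) (fun x : B => ((h x)%:R * u x)%:E : \bar R).
  exact: (@weighted_measurable C h u C (@subset_refl _ C) mC mh uc).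
apply/integrableP; split=> //.
have mCK : measurable (C `&` K : set B) by exact: measurableI.
have mg : measurable_fun (C `&` K : set B) (fun x : B => ((h x)%:R : R)%:E : \bar R).
  apply/measurable_EFinP; apply: (@measurable_funS _ _ _ _ (C : set B)) => //.
  exact: nat_measurable_fun.
have -> : \int[mu]_(x in (C : set B)) `|((h x)%:R * u x)%:E| =
    \int[mu]_(x in (C `&` K : set B)) `|((h x)%:R * u x)%:E|.
  rewrite integral_mkcondr; apply: eq_integral => x _; rewrite patchE.
  by case: ifPn => // /negP xK; rewrite uK ?mulr0 ?abse0 // => Kx; apply: xK; exact/mem_set.
apply: (@le_lt_trans _ _ (\int[mu]_(x in (C `&` K : set B)) (M%:E * ((h x)%:R)%:E))).
  apply: ge0_le_integral => //.
  - apply: measurableT_comp => //; apply: (@measurable_funS _ _ _ _ (C : set B)) => //.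
  - by apply: measurable_funeM.
  - move=> x [_ Kx]; rewrite -EFinM lee_fin normrM ger0_norm // mulrC ler_wpM2r //.
    exact: uM.
rewrite ge0_integralZl //.
by apply: lte_mul_pinfty => //; exact: hfin.
Qed.

End WeightedIntegrals.

(** * The minimizing property *)

Section CalibratedGraphs.
Context {R : realType} {k : nat}.
Local Notation E := 'rV[R]_(k.+1 + 1).
Local Notation B := (borelRn R (k.+1 + 1)).
Local Notation mu := (@hausdorff R k.+1 (k.+1 + 1)).
Context (U : set 'rV[R]_k.+1) (psi : E -> R) (f : 'rV[R]_k.+1 -> R).
Context (oU : open U) (psi_smooth : smooth setT psi).
Context (psi_indep : forall p q : E, lsubmx p = lsubmx q -> psi p = psi q).
Context (f_smooth : smooth U f) (minS : weighted_minimal U psi f).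
Context (T : ohypersurface R k.+1) (A : E -> int) (K0 : set E).
Context (hT : is_hypersurface (cylinder U) T) (A0 : forall x, ~ K0 x -> A x = 0).
Context (hA : differ_by_boundary (cylinder U) (graph_hypersurface U f) T A).
Context (cK0 : compact K0) (K0U : K0 `<=` cylinder U).
Implicit Types (chi : E -> R) (K : set E).
Let W : set E := cylinder U.
Let u chi (x : E) : R := chi x * expR (psi x).

Let psi_continuous : continuous psi.
Proof. by move=> x; exact: (Ck_continuous (psi_smooth 0%N)). Qed.

Let weight_continuous : continuous (fun x => expR (psi x)).
Proof.
by move=> x; exact: (continuous_comp (@psi_continuous x) (@continuous_expR R (psi x))).
Qed.

Let T_finite : locally_finite_on W (carrier T) (mult T).
Proof. by case: hT => [_ [m1 _ m2] _ fin _]. Qed.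

Let S_finite : locally_finite_on W (graph U f) (fun=> 1%N).
Proof. by apply: locally_finite_graph => //; exact: f_smooth. Qed.

Let u_continuous K chi : cutoff W K chi -> continuous (u chi).
Proof.
move=> [chiC _ _ _] x.
exact: (cvgM (Ck_continuous (chiC 0%N) I) (@weight_continuous x)).
Qed.

Let u_ge0 K chi x : cutoff W K chi -> 0 <= u chi x.
Proof. by move=> [_ b _ _]; rewrite mulr_ge0 ?expR_ge0 //; have /andP[] := b x. Qed.

Let integrable_u K chi C h : cutoff W K chi -> locally_finite_on W C h ->
  mu.-integrable C (fun x : B => ((h x)%:R * u chi x)%:E).
Proof.
move=> hchi lC; have [_ _ [K' [cK' KW' z]] _] := hchi.
apply: (weighted_integrable lC _ cK' KW'); first exact: (u_continuous hchi).
by move=> x /z; rewrite /u => ->; rewrite mul0r.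
Qed.

(** Let X = chi e^psi n.  By Stokes' formula the fluxes of X through the graph and
    through T are equal: div X is 0 on the support of A, because chi is 1 nearby.
    The first flux density is chi e^psi, and the second is at most chi e^psi by
    the Cauchy-Schwarz inequality.  All the integrals are finite, so [fine] does
    not alter them. *)
Lemma calibration_inequality chi : cutoff W K0 chi ->
  (\int[mu]_(x in (graph U f : set B)) ((1%:R : R) * u chi x)%:E <=
   \int[mu]_(x in (carrier T : set B)) ((mult T x)%:R * u chi x)%:E)%E.
Proof.
move=> hchi; pose X p := chi p *: weighted_normal psi f p.
have smW : smooth W psi by move=> j; apply: Ck_subset (psi_smooth j).
have tX : test_field W X by apply: test_field_cutoff hchi.
have dotX p v : dot (X p) v = u chi p * dot (graph_normal f p) v.
  rewrite /dot mulr_sumr; apply: eq_bigr => i _.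
  by rewrite [X p 0 i]mxE [weighted_normal _ _ _ _ _]mxE /u; ring.
have intS := integrable_u hchi S_finite.
have intT := integrable_u hchi T_finite.
have [mC mh _] := T_finite; have [mS _ _] := S_finite.
have [_ [_ mn _] unitT _ _] := hT.
have dot_le1 x : carrier T x -> `|dot (graph_normal f x) (normal T x)| <= 1.
  move=> /unitT[n1 _]; have nn : dot (normal T x) (normal T x) = 1.
    by rewrite -[LHS]sqr_sqrtr ?dot_ge0 // -/(enorm _) n1 expr1n.
  rewrite ler_norml dot_unit_le1 ?dot_graph_normal // andbT lerNl.
  have -> : - dot (graph_normal f x) (normal T x) = dot (graph_normal f x) (- normal T x).
    by rewrite /dot -sumrN; apply: eq_bigr => i _; rewrite [(- normal T x) 0 i]mxE mulrN.
  apply: dot_unit_le1; first exact: dot_graph_normal.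
  by rewrite -nn /dot; apply: eq_bigr => i _; rewrite [(- normal T x) 0 i]mxE mulrNN.
have intJ : mu.-integrable (carrier T : set B)
    (fun x : B => ((mult T x)%:R * dot (X x) (normal T x))%:E).
  apply: le_integrable intT => //.
    apply/measurable_EFinP; apply: measurable_funM; first exact: nat_measurable_fun.
    apply: measurable_sum => i; apply: measurable_funM; last exact: mn.
    by apply: continuous_borel => x; exact: (Ck_continuous (tX.1 i 0%N)).
  move=> x Tx; rewrite lee_fin dotX !normrM ler_wpM2l // ler_piMr //.
  exact: dot_le1.
have JI : (\int[mu]_(x in (carrier T : set B)) ((mult T x)%:R * dot (X x) (normal T x))%:E <=
    \int[mu]_(x in (carrier T : set B)) ((mult T x)%:R * u chi x)%:E)%E.
  apply: le_integral => // x; rewrite inE => Tx.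
  rewrite lee_fin dotX ler_wpM2l // ler_piMr ?(u_ge0 _ hchi) //.
  by apply: le_trans (dot_le1 x Tx); exact: ler_norm.
apply: le_trans JI.
have := hA tX; rewrite (@fine_integral0 _ B R _ (fun x : B => (A x)%:~R * div X x : R)); last first.
  move=> x; have [K0x|/A0 ->] := pselect (K0 x); last by rewrite mul0r.
  rewrite (div_near_eq (Y := weighted_normal psi f)); last first.
    have [_ _ _ one] := hchi.
    near=> y; rewrite /X (_ : chi y = 1) ?scale1r //; near: y; exact: one.
  rewrite (@div_weighted_normal _ _ U) ?mulr0 //.
  exact: K0U.
move=> /subr0_eq; rewrite /flux /=.
under eq_integral => x _ do rewrite dotX dot_graph_normal mulr1.
move=> e; rewrite -(fineK (integrable_fin_num _ intS)) //.
rewrite [X in (X%:E <= _)%E]e fineK //.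
exact: integrable_fin_num intJ.
Unshelve. all: by end_near. Qed.

Local Notation area h C := (\int[mu]_(x in (C : set B)) ((h x)%:R * expR (psi x))%:E)%E.

Let u_one K chi x : cutoff W K chi -> K x -> u chi x = expR (psi x).
Proof. by move=> [_ _ _ one] /one /nbhs_singleton c1; rewrite /u c1 mul1r. Qed.

Let measurable_u K chi C (h : E -> nat) (D : set B) : cutoff W K chi ->
  locally_finite_on W C h -> D `<=` C ->
  measurable_fun D (fun x : B => ((h x)%:R * u chi x)%:E : \bar R).
Proof.
move=> hchi [mC mh _] DC; apply: (weighted_measurable DC) => //.
exact: (u_continuous hchi).
Qed.

Let term_ge0 K chi (h : E -> nat) x : cutoff W K chi -> (0 <= ((h x)%:R * u chi x)%:E)%E.
Proof. by move=> hchi; rewrite lee_fin mulr_ge0 // (u_ge0 _ hchi). Qed.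

Let area_cutoff K L chi C (h : E -> nat) : cutoff W L chi -> K `<=` L ->
  area h (C `&` K) = (\int[mu]_(x in (C `&` K : set B)) ((h x)%:R * u chi x)%:E)%E.
Proof.
move=> hchi KL; apply: eq_integral => x; rewrite inE => -[_ Kx].
by rewrite (u_one hchi) //; exact: KL.
Qed.

(** Apply [calibration_inequality] with chi equal to 1 on K. *)
Lemma area_in_compact_le K : compact K -> K `<=` W ->
  (area (fun=> 1%N) (graph U f `&` K) <= area (mult T) (carrier T `&` setT))%E.
Proof.
move=> cK KW; have oW : open W by exact: open_cylinder.
have [chi hchi] : exists chi, cutoff W (K0 `|` K) chi.
  apply: cutoff_exists => //; first exact: compactU.
  by move=> x [/K0U|/KW].
have hchi0 : cutoff W K0 chi by apply: cutoff_subset hchi; exact: subsetUl.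
have [mS _ _] := S_finite; have [mT mh _] := T_finite.
rewrite (area_cutoff _ _ hchi (@subsetUr _ _ _)) setIT.
apply: (@le_trans _ _ (\int[mu]_(x in (graph U f : set B)) ((1%:R : R) * u chi x)%:E)%E).
  apply: ge0_subset_integral => //.
  - by apply: measurableI => //; exact: compact_borel.
  - exact: (measurable_u hchi S_finite).
  - by move=> x _; exact: (term_ge0 (fun=> 1%N) _ hchi).
apply: le_trans (calibration_inequality hchi0) _.
apply: ge0_le_integral => //.
- by move=> x _; exact: (term_ge0 _ _ hchi).
- exact: (measurable_u hchi T_finite).
- by apply: (weighted_measurable (@subset_refl _ (carrier T))).
- move=> x _; rewrite lee_fin ler_wpM2l // /u ler_piMl ?expR_ge0 //.
  by have [_ b _ _] := hchi; have /andP[] := b x.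
Qed.

Lemma total_area_le :
  (area (fun=> 1%N) (graph U f `&` setT) <= area (mult T) (carrier T `&` setT))%E.
Proof.
have oW : open W by exact: open_cylinder.
have [K [cK Kmono KW]] := compact_exhaustion oW.
have [mS _ _] := S_finite.
have mSK j : measurable (graph U f `&` K j : set B).
  by apply: measurableI => //; apply: compact_borel; exact: (cK j).1.
have SK : graph U f `&` setT = \bigcup_j (graph U f `&` K j).
  by rewrite setIT -setI_bigcupr setIidl // => x [Ux _]; exact: KW.
have cvgK : (area (fun=> 1%N) (graph U f `&` K j) @[j --> \oo] -->
    area (fun=> 1%N) (\bigcup_j (graph U f `&` K j)))%E.
  apply: ge0_nondecreasing_set_cvg_integral => //.
  - by move=> i j ij; rewrite subsetEset; apply: setIS; exact: Kmono.
  - by move=> j; apply: (weighted_measurable (@subIsetl _ (graph U f) (K j))).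
rewrite SK -(cvg_lim _ cvgK) //; apply: lime_le; first by apply/cvg_ex; eexists; exact: cvgK.
by apply: nearW => j; apply: area_in_compact_le; have [] := cK j.
Qed.

(** The exceptional null set N of [coincide_outside] need not be Borel, but the set
    where T differs from the graph off K is Borel and lies in N; so it may be
    removed from the domain of integration. *)
Lemma area_off_coincidence_le K : compact K -> coincide_outside K (graph_hypersurface U f) T ->
  forall L chi, cutoff W L chi ->
  (\int[mu]_(x in (carrier T `\` K : set B)) ((mult T x)%:R * u chi x)%:E <=
   \int[mu]_(x in (graph U f `\` K : set B)) ((1%N%:R : R) * u chi x)%:E)%E.
Proof.
move=> cK [N N0 hN] L chi hchi; have mK := compact_borel cK.
have [mS _ _] := S_finite; have [mT mh _] := T_finite.
have mSK : measurable (graph U f `\` K : set B) by exact: measurableD.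
have mTK : measurable (carrier T `\` K : set B) by exact: measurableD.
(* the part of T off K where T agrees with the graph *)
pose G : set E := (graph U f `\` K) `&` (carrier T `&` mult T @^-1` [set 1%N]).
have mG : measurable (G : set B) by apply: measurableI => //; exact: mh.
have GT : G `<=` carrier T `\` K by move=> x [[_ nK] [Tx _]].
have G0 : mu ((carrier T `\` K) `\` G : set B) = 0%E.
  apply/eqP; rewrite eq_le hausdorff_ge0 andbT -N0; apply: le_hausdorff => x [[Tx nK] nG].
  apply: contrapT => nN; have [[_ TS] ST] := hN x nK nN.
  by apply: nG; split; [split=> //; exact: TS|split=> //=; have [_ <-] := ST (TS Tx)].
rewrite (ge0_negligible_integral (N := (carrier T `\` K) `\` G : set B)) //; last first.
- by move=> x _; exact: (term_ge0 _ _ hchi).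
- by apply: (measurable_u hchi T_finite); exact: subDsetl.
- exact: measurableD.
rewrite setDD (setIidr GT).
rewrite (eq_integral (fun x : B => ((1%N%:R : R) * u chi x)%:E)); last first.
  by move=> x; rewrite inE => -[_ [_ /= ->]].
apply: ge0_subset_integral => //.
- by apply: (measurable_u hchi S_finite); exact: subDsetl.
- by move=> x _; exact: (term_ge0 (fun=> 1%N) _ hchi).
- by move=> x [].
Qed.

(** In [calibration_inequality] with chi equal to 1 on K, the contributions off K
    cancel by [area_off_coincidence_le]. *)
Lemma local_area_le K : compact K -> K `<=` W ->
  coincide_outside K (graph_hypersurface U f) T ->
  (area (fun=> 1%N) (graph U f `&` K) <= area (mult T) (carrier T `&` K))%E.
Proof.
move=> cK KW coin; have oW : open W by exact: open_cylinder.
have [chi hchi] : exists chi, cutoff W (K0 `|` K) chi.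
  apply: cutoff_exists => //; first exact: compactU.
  by move=> x [/K0U|/KW].
have hchi0 : cutoff W K0 chi by apply: cutoff_subset hchi; exact: subsetUl.
have mK := compact_borel cK.
have [mS _ _] := S_finite; have [mT mh _] := T_finite.
have split_int C h : locally_finite_on W C h ->
    (\int[mu]_(x in (C : set B)) ((h x)%:R * u chi x)%:E =
     area h (C `&` K) + \int[mu]_(x in (C `\` K : set B)) ((h x)%:R * u chi x)%:E)%E.
  move=> lC; have [mC _ _] := lC.
  rewrite (area_cutoff _ _ hchi (@subsetUr _ _ _)) -[in LHS](setUIDK C K) ge0_integral_setU //.
  - exact: measurableI.
  - exact: measurableD.
  - by rewrite setUIDK; exact: (measurable_u hchi lC).
  - by move=> x _; exact: (term_ge0 _ _ hchi).
  - by apply/disj_setPS => x [[_ Kx] [_ nKx]].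
have := calibration_inequality hchi0.
rewrite (split_int _ _ S_finite) (split_int _ _ T_finite) => h.
have bfin : (\int[mu]_(x in (graph U f `\` K : set B)) ((1%N%:R : R) * u chi x)%:E)%E \is a fin_num.
  apply: integrable_fin_num; first exact: measurableD.
  by apply: integrableS (integrable_u hchi S_finite) => //; exact: measurableD.
rewrite -(leeD2rE _ _ bfin); apply: le_trans h _; apply: leeD2l.
exact: area_off_coincidence_le hchi.
Qed.

End CalibratedGraphs.

Unset Implicit Arguments.

Theorem mainTheorem2 (R : realType) (m : nat) (hm : (0 < m)%N)
    (U : set 'rV[R]_m) (U_open : open U) (U_connected : connected U)
    (U_nonempty : U !=set0)
    (psi : 'rV[R]_(m + 1) -> R) (psi_smooth : smooth setT psi)
    (psi_indep : forall p q : 'rV[R]_(m + 1),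
       lsubmx p = lsubmx q -> psi p = psi q)
    (f : 'rV[R]_m -> R) (f_smooth : smooth U f)
    (S_minimal : weighted_minimal U psi f) :
  weighted_area_minimizing (cylinder U) psi (graph_hypersurface U f).
Proof.
case: m hm U U_open U_connected U_nonempty psi psi_smooth psi_indep f f_smooth
  S_minimal => [//|k] _ U oU _ _ psi psi_smooth psi_indep f f_smooth minS.
move=> T hT [_ [A [[_ _ [K0 [cK0 K0U A0]]] hA]]]; split.
  exact: total_area_le hT A0 hA cK0 K0U.
by move=> K cK KU coin; exact: local_area_le hT A0 hA cK0 K0U K cK KU coin.
Qed.
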